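(* Let $k\ge 2$, let $P(\lambda)=\sum_{i=0}^kA_i\lambda^i\in\mathbb{F}[\lambda]^{n\times n}$ be a matrix polynomial of grade $k$, and let $K_{\mathbf q,\mathbf z}(\lambda)=\lambda M_{\mathbf z}^P-M_{\mathbf q}^P$ be the proper generalized Fiedler pencil associated with $P(\lambda)$ and $(\mathbf q,\mathbf z)$. Let $(\widehat{\mathbf q},h)$ be the simple pair associated with $K_{\mathbf q,\mathbf z}(\lambda)$, and set $p:=\mathfrak h(\widehat{\mathbf q})-1$ and $q:=\mathfrak h(\mathrm{rev}(\widehat{\mathbf q}))+k-h-2$. Then there exist block-permutation matrices $\Pi_{\boldsymbol\ell}^n$ and $\Pi_{\mathbf r}^n$ such that $$(\Pi_{\boldsymbol\ell}^n)^{\mathcal B}K_{\mathbf q,\mathbf z}(\lambda)\Pi_{\mathbf r}^n=\begin{bmatrix} M(\lambda) & L_q(\lambda)^T\otimes I_n\\ L_p(\lambda)\otimes I_n & 0\end{bmatrix}$$ is a $(p,n,q,n)$-block Kronecker pencil whose body $M(\lambda)$ satisfies the AS condition for $P(\lambda)$. Moreover, the following statements hold. (a) The wing block-columns of $(\Pi_{\boldsymbol\ell}^n)^{\mathcal B}K_{\mathbf q,\mathbf z}(\lambda)$ relative to $(\mathbf{id},\mathbf r,p,q)$ are of the form $-e_i\otimes I_n+\lambda e_{i+1}\otimes I_n$, for some $1\le i\le q$, and are located in the positions $j\in\{1,\dots,k\}$ such that $(\mathbf q,k-j)$ and $(\mathbf z+k,j-1)$ satisfy the SIP. (b) The wing block-rows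 of $K_{\mathbf q,\mathbf z}(\lambda)\Pi_{\mathbf r}^n$ relative to $(\boldsymbol\ell,\mathbf{id},p,q)$ are of the form $-e_i^T\otimes I_n+\lambda e_{i+1}^T\otimes I_n$, for some $1\le i\le p$, and are located in the positions $j\in\{1,\dots,k\}$ such that $(k-j,\mathbf q)$ and $(j-1,\mathbf z+k)$ satisfy the SIP.
   Context: Basic notation. $\mathbb F$ is an arbitrary field; a matrix polynomial has grade $k$ if it is written $\sum_{i=0}^kA_i\lambda^i$ (where $A_k=0$ is allowed); a pencil is a matrix polynomial of grade 1. $a:b$ denotes $a,a+1,\dots,b$ if $a\le b$ and is empty otherwise. $e_i$ is the $i$th column of an identity matrix of the appropriate size. $L_s(\lambda)$ is the $s\times(s+1)$ pencil with $(i,i)$ entry $-1$, $(i,i+1)$ entry $\lambda$, and zeros elsewhere. All block-matrices are partitioned into $n\times n$ blocks; the block-transpose $H^{\mathcal B}$ of $H=[H_{ij}]$ is the block-matrix with block $H_{ji}$ in position $(i,j)$. Elementary matrices ($kn\times kn$). For an $n\times n$ matrix $B$: $M_0(B)=I_{(k-1)n}\oplus B$; $M_{-k}(B)=B\oplus I_{(k-1)n}$; and for $i=1:k-1$, $M_i(B)=I_{(k-i-1)n}\oplus\begin{bmatrix}B&I_n\\ I_n&0\end{bmatrix}\oplus I_{(i-1)n}$ and $M_{-i}(B)=I_{(k-i-1)n}\oplus\begin{bmatrix}0&I_n\\ I_n&B\end{bmatrix}\oplus I_{(i-1)n}$. Put $M_i^P=M_i(-A_i)$ for $i=0:k-1$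 and $M_{-i}^P=M_{-i}(A_i)$ for $i=1:k$. For a tuple $\mathbf t=(t_1,\dots,t_r)$, $M_{\mathbf t}^P=M_{t_1}^P\cdots M_{t_r}^P$ (the identity if $\mathbf t$ is empty). Index tuples. An index tuple is a finite sequence of integers; $\mathrm{rev}(\mathbf t)$ is the reversed tuple, $-\mathbf t$ and $a+\mathbf t$ are entrywise, and $(\mathbf t_1,\mathbf t_2)$ is concatenation. A tuple $(i_1,\dots,i_r)$ of only nonnegative or only negative integers satisfies the SIP if whenever $i_a=i_b$ with $a<b$ there is $c$ with $a<c<b$ and $i_c=i_a+1$. Two tuples of nonnegative integers are equivalent if one is obtained from the other by finitely many interchanges of adjacent distinct indices $s,t$ with $|s-t|\neq1$ (and similarly for negative integers). A tuple of nonnegative integers is in column standard form if it equals $(a_s:b_s,\dots,a_1:b_1)$ with $b_s>\dots>b_1\ge0$ and $0\le a_j\le b_j$. Each tuple $\mathbf t$ of nonnegative integers satisfying the SIP is equivalent to a unique tuple in column standard form, $\mathrm{csf}(\mathbf t)=(a_s:b_s,\dots,a_1:b_1)$; then $\mathrm{heads}(\mathbf t)=\{b_1,\dots,b_s\}$ and $\mathfrak h(\mathbf t)=s$. Generalized Fiedler pencils. Let $\{C_0,C_1\}$ be a partition of $\{0:k\}$ and let $\mathbf q,\mathbf z$ be permutations of $C_0$ and $-C_1$. The pencil $\lambda M^P_{\mathbf z}-M^P_{\mathbf q}$ is the generalized Fiedler pencil associated with $P$ and $(\mathbf q,\mathbf z)$; it is proper if $0\in C_0$ and $k\in C_1$.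 For a proper one there are $h\in\{0:k-1\}$ and a tuple $\mathbf m$ such that $\mathbf z$ is equivalent to $(\mathbf m,-k:-h-1)$, so that $K_{\mathbf q,\mathbf z}(\lambda)=\lambda M^P_{(\mathbf m,-k:-h-1)}-M^P_{\mathbf q}$, and $\widehat{\mathbf q}:=(-\mathrm{rev}(\mathbf m),\mathbf q)$ is a permutation of $\{0:h\}$; $(\widehat{\mathbf q},h)$ is called the simple pair associated with $K_{\mathbf q,\mathbf z}(\lambda)$. Block Kronecker pencils, wings. A $(p,n,q,n)$-block Kronecker pencil is a pencil $\begin{bmatrix}M(\lambda)&L_q(\lambda)^T\otimes I_n\\ L_p(\lambda)\otimes I_n&0\end{bmatrix}$ with $M(\lambda)$ any pencil of size $(q+1)n\times(p+1)n$, its body (the cases $p=0$ or $q=0$, with the corresponding blocks absent, are allowed). For a permutation $\mathbf c=(c_1,\dots,c_k)$ of $\{1:k\}$, $\Pi^n_{\mathbf c}$ is the $k\times k$ block-matrix with $I_n$ in block positions $(c_i,i)$ and $0$ elsewhere; $\mathbf{id}$ is the identity permutation. If $(\Pi^n_{\boldsymbol\ell})^{\mathcal B}L(\lambda)\Pi^n_{\mathbf r}$ is a $(p,n,q,n)$-block Kronecker pencil $\begin{bmatrix}M(\lambda)&L_q(\lambda)^T\otimes I_n\\ L_p(\lambda)\otimes I_n&0\end{bmatrix}$ with $k=p+q+1$, the body block-rows (resp. body block-columns) of $L(\lambda)$ relative to $(\boldsymbol\ell,\mathbf r,p,q)$ are those block-rows (resp. block-columns) of $L(\lambda)$ that after the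 permutations occupy the first $q+1$ block-rows (resp. first $p+1$ block-columns); the others are the wing block-rows (resp. wing block-columns). AS condition. For a pencil $M(\lambda)=\lambda M_1+M_0\in\mathbb F[\lambda]^{(q+1)n\times(p+1)n}$ with $k=p+q+1$ and $s\in\{0:k\}$, put $\mathrm{AS}(M,s)=\sum_{i+j=k+2-s}[M_1]_{ij}+\sum_{i+j=k+1-s}[M_0]_{ij}$ (sums over $n\times n$ blocks). $M(\lambda)$ satisfies the AS condition for $P(\lambda)$ if $\mathrm{AS}(M,s)=A_s$ for $s=0:k$. *)

(* Defs.v *)
From HB Require Import structures.
From mathcomp Require Import all_boot all_order all_fingroup all_algebra.
From mathcomp Require Import boolp classical_sets.
From mathcomp Require Export mxtens.

Set Implicit Arguments.
Unset Strict Implicit.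
Unset Printing Implicit Defensive.

Import Order.TTheory GRing.Theory Num.Theory.
Local Open Scope ring_scope.

(* Matrix polynomials are matrices over {poly F}.                             *)
(* A block-matrix with n x n blocks is a matrix of size (r * n) x (c * n);    *)
(* its blocks are addressed through mxtens_index, so that A *t 1%:M is the    *)
(* Kronecker product of A with I_n.  Ordinals are 0-based: i : 'I_r stands    *)
(* for the i.+1-st block-row (or block-column).                               *)

Section MatrixPolynomials.
Variables (F : fieldType) (m n : nat).

Definition has_grade (k : nat) (A : 'M[{poly F}]_(m, n)) : Prop :=
  forall i j, (size (A i j) <= k.+1)%N.

Definition coefmx (s : nat) (A : 'M[{poly F}]_(m, n)) : 'M[F]_(m, n) :=
  map_mx (fun f : {poly F} => f`_s) A.

Definition pencil (A1 A0 : 'M[F]_(m, n)) : 'M[{poly F}]_(m, n) :=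
  'X *: map_mx polyC A1 + map_mx polyC A0.

End MatrixPolynomials.

Section BlockMatrices.
Variables (R : Type) (n : nat).

Definition blk r c (A : 'M[R]_(r * n, c * n)) (i : 'I_r) (j : 'I_c) : 'M[R]_n :=
  \matrix_(a, b) A (mxtens_index (i, a)) (mxtens_index (j, b)).

Definition blockmx r c (B : 'I_r -> 'I_c -> 'M[R]_n) : 'M[R]_(r * n, c * n) :=
  \matrix_(i, j) B (mxtens_unindex i).1 (mxtens_unindex j).1
                   (mxtens_unindex i).2 (mxtens_unindex j).2.

Definition block_trmx r c (A : 'M[R]_(r * n, c * n)) : 'M[R]_(c * n, r * n) :=
  blockmx (fun i j => blk A j i).

Definition block_col r c (A : 'M[R]_(r * n, c * n)) (j : 'I_c) :
    'M[R]_(r * n, 1 * n) :=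
  blockmx (fun i _ => blk A i j).

Definition block_row r c (A : 'M[R]_(r * n, c * n)) (i : 'I_r) :
    'M[R]_(1 * n, c * n) :=
  blockmx (fun _ j => blk A i j).

End BlockMatrices.

(* The permutation i.+1 |-> (c i).+1 of {1:k} gives the block I_n in the      *)
(* block positions (c i, i).                                                  *)
Definition block_perm_mx (R : pzRingType) (n k : nat) (c : 'S_k) :
    'M[R]_(k * n) :=
  (\matrix_(i < k, j < k) (i == c j)%:R) *t (1%:M : 'M_n).

(* i is 1-based, as in e_1, ..., e_k.                                         *)
Definition ecol (R : pzRingType) (k i : nat) : 'cV[R]_k :=
  \col_(a < k) (a.+1 == i)%:R.

Definition Lpencil (F : fieldType) (s : nat) : 'M[{poly F}]_(s, s.+1) :=
  \matrix_(i < s, j < s.+1)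
    (if j == i :> nat then -1 else if j == i.+1 :> nat then 'X else 0).

Definition string (a b : int) : seq int :=
  if a <= b then [seq a + i%:Z | i <- iota 0 `|b - a|%N.+1] else [::].

Definition neg_tuple (t : seq int) : seq int := [seq - i | i <- t].
Definition shift_tuple (a : int) (t : seq int) : seq int := [seq a + i | i <- t].

Definition SIP (t : seq int) : Prop :=
  forall a b : nat, (a < b < size t)%N -> t`_a = t`_b ->
  exists2 c : nat, (a < c < b)%N & t`_c = t`_a + 1.

Inductive tuple_equiv : seq int -> seq int -> Prop :=
| tuple_equiv_refl t : tuple_equiv t t
| tuple_equiv_swap (u v w : seq int) (s t : int) :
    s != t -> `|s - t| != 1 ->
    tuple_equiv (u ++ t :: s :: v) w -> tuple_equiv (u ++ s :: t :: v) w.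

(* c lists the pairs (a_s, b_s), ..., (a_1, b_1) of a column standard form    *)
(* (a_s:b_s, ..., a_1:b_1) equivalent to t.                                   *)
Definition is_csf (t : seq int) (c : seq (int * int)) : Prop :=
  [/\ sorted (fun x y : int * int => y.2 < x.2) c,
      all (fun x : int * int => 0 <= x.1 <= x.2) c
    & tuple_equiv t (flatten [seq string x.1 x.2 | x <- c])].

(* For a tuple of nonnegative integers satisfying the SIP there is exactly    *)
(* one such c, and xget selects it.                                           *)
Definition csf (t : seq int) : seq (int * int) := xget [::] (is_csf t).

Definition heads (t : seq int) : seq int := [seq x.2 | x <- csf t].
Definition nheads (t : seq int) : nat := size (heads t).

Section Elementary.
Variables (F : fieldType) (n k : nat).

Definition dsum m1 m2 (A : 'M[F]_m1) (B : 'M[F]_m2) : 'M[F]_(m1 + m2) :=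
  block_mx A 0 0 B.

(* For -k <= i < k the direct sums below have size k * n up to a propositional *)
(* equality, along which conform_mx transports them; the default value 1%:M   *)
(* only serves the other indices, for which there is no matrix M_i.           *)
Definition elem_mx (i : int) (B : 'M[F]_n) : 'M[F]_(k * n) :=
  match i with
  | Posz 0 => conform_mx 1%:M (dsum (1%:M : 'M_((k - 1) * n)) B)
  | Posz i =>
      conform_mx 1%:M
        (dsum (1%:M : 'M_((k - i - 1) * n))
              (dsum (block_mx B 1%:M 1%:M 0) (1%:M : 'M_((i - 1) * n))))
  | Negz j =>
      let i := j.+1 in
      if i == k then conform_mx 1%:M (dsum B (1%:M : 'M_((k - 1) * n)))
      else
        conform_mx 1%:M
          (dsum (1%:M : 'M_((k - i - 1) * n))
                (dsum (block_mx 0 1%:M 1%:M B) (1%:M : 'M_((i - 1) * n))))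
  end.

Variable P : 'M[{poly F}]_n.

Definition fiedler_mx (i : int) : 'M[F]_(k * n) :=
  match i with
  | Posz i => elem_mx i%:Z (- coefmx i P)
  | Negz j => elem_mx (Negz j) (coefmx j.+1 P)
  end.

Definition fiedler_prod (t : seq int) : 'M[F]_(k * n) :=
  \prod_(i <- t) fiedler_mx i.

Definition GFP (tq tz : seq int) : 'M[{poly F}]_(k * n) :=
  pencil (fiedler_prod tz) (- fiedler_prod tq).

End Elementary.

(* The last two conditions say that the pencil is proper; C0 and C1 are then  *)
(* nonempty.                                                                  *)
Definition proper_GFP_tuples (k : nat) (C0 C1 : {set 'I_k.+1})
    (tq tz : seq int) : Prop :=
  [/\ (C0 :|: C1 = [set: 'I_k.+1])%SET /\ [disjoint C0 & C1],
      perm_eq tq [seq (nat_of_ord i)%:Z | i <- enum C0],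
      perm_eq tz [seq - (nat_of_ord i)%:Z | i <- enum C1],
      ord0 \in C0
    & ord_max \in C1].

Definition simple_pair (k : nat) (tq tz hq : seq int) (h : nat) : Prop :=
  (h < k)%N /\
  exists m : seq int,
    [/\ tuple_equiv tz (m ++ string (- k%:Z) (- h%:Z - 1)),
        hq = neg_tuple (rev m) ++ tq
      & perm_eq hq (string 0 h%:Z)].

Section BlockKronecker.
Variables (F : fieldType) (n p q : nat).
Implicit Types M : 'M[{poly F}]_(q.+1 * n, p.+1 * n).

Definition block_kronecker M :
    'M[{poly F}]_(q.+1 * n + p * n, p.+1 * n + q * n) :=
  block_mx M ((Lpencil F q)^T *t (1%:M : 'M_n))
           (Lpencil F p *t (1%:M : 'M_n)) 0.

Lemma bk_rows k : k = (p + q + 1)%N -> (k * n = q.+1 * n + p * n)%N.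
Proof. by move=> ->; rewrite -mulnDl addn1 addSn addnC. Qed.

Lemma bk_cols k : k = (p + q + 1)%N -> (k * n = p.+1 * n + q * n)%N.
Proof. by move=> ->; rewrite -mulnDl addn1 addSn. Qed.

(* L is the (p, n, q, n)-block Kronecker pencil with body M.                  *)
Definition is_block_kronecker k (L : 'M[{poly F}]_(k * n)) M : Prop :=
  has_grade 1 M /\
  exists e : k = (p + q + 1)%N,
    castmx (bk_rows e, bk_cols e) L = block_kronecker M.

Definition AS M (s : nat) : 'M[F]_n :=
  let k := (p + q + 1)%N in
  \sum_(i < q.+1) \sum_(j < p.+1 | (i.+1 + j.+1 == k + 2 - s)%N)
     blk (coefmx 1 M) i j
  + \sum_(i < q.+1) \sum_(j < p.+1 | (i.+1 + j.+1 == k + 1 - s)%N)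
     blk (coefmx 0 M) i j.

Definition AS_condition M (P : 'M[{poly F}]_n) : Prop :=
  forall s : nat, (s <= p + q + 1)%N -> AS M s = coefmx s P.

End BlockKronecker.

(* Block-column j of L is block-column (r^-1 j) of L *m block_perm_mx r, and  *)
(* block-row j of L is block-row (l^-1 j) of the product of the               *)
(* block-transpose of block_perm_mx l with L.  The wing block-columns         *)
(* (block-rows) relative to (l, r, p, q) depend on r and p (l and q) only.    *)
Definition wing_cols (k : nat) (r : 'S_k) (p : nat) : {set 'I_k} :=
  [set j | p.+1 <= (r^-1)%g j]%N.
Definition wing_rows (k : nat) (l : 'S_k) (q : nat) : {set 'I_k} :=
  [set j | q.+1 <= (l^-1)%g j]%N.

Arguments GFP {F n} k P tq tz.
Arguments AS {F n p q} M s.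
Arguments AS_condition {F n p q} M P.
Arguments is_block_kronecker {F n p q k} L M.
Arguments block_perm_mx R n {k} c.

(* Main.v *)
(* Each elementary matrix swaps two adjacent block positions and adds one block
   B, so that M_t, for t without repetitions, is a partial permutation matrix
   plus one copy of each block.  The block-row u of M_t is a single identity
   block as soon as u + 1 precedes u in t, or u is not in t; the identity then
   sits at the end of the run u + 1, u + 2, ... of indices in increasing order
   in t.  Columns behave in the same way with t reversed.  A block-row is a wing
   block-row when both M_q and M_z have only an identity in it, which is what the
   SIP conditions say; its entries -I_n and lambda I_n are in two consecutive body
   block-columns, hence the block Kronecker form.
   The block A_s lands in the body block-row and the body block-column nearest to
   s, going up if s is in C_0 and down if s is in C_1.  The number of body rows
   plus the number of body columns among the first e positions is e if k - e is in
   C_1 and e + 1 if it is in C_0; this gives both the AS condition and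
   p + q + 1 = k.  Finally the heads of the column standard form of a permutation
   of 0:h are h and the x such that x + 1 precedes x; for the simple pair these
   are exactly the body block-columns. *)
Require Import Defs.
From mathcomp Require Import all_boot all_order all_fingroup all_algebra.
From mathcomp Require classical_sets.
From mathcomp Require Import zify.

Set Implicit Arguments.
Unset Strict Implicit.
Unset Printing Implicit Defensive.

Import Order.TTheory GRing.Theory Num.Theory.

(** * Relative order of two indices in a tuple *)

(** Comparing the whole filtered list makes both memberships part of the relation, so its negation
    also covers an absent index. *)
Definition prec (T : eqType) (t : seq T) (x y : T) : bool :=
  filter (pred2 x y) t == [:: x; y].

Section Prec.
Variable T : eqType.
Implicit Types (t : seq T) (x y : T).

Lemma prec_mem t x y : prec t x y -> (x \in t) && (y \in t).
Proof.
move/eqP=> e; have h z : z \in [:: x; y] -> z \in t.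
  by rewrite -e mem_filter => /andP[].
by rewrite !h ?inE ?eqxx ?orbT.
Qed.

Lemma prec_rev t x y : prec (rev t) x y = prec t y x.
Proof.
rewrite /prec filter_rev -[[:: x; y]]/(rev [:: y; x]) (inj_eq (can_inj revK)).
by congr (_ == _); apply: eq_filter => z /=; rewrite orbC.
Qed.

Lemma prec_map (U : eqType) (f : T -> U) t x y :
  injective f -> prec (map f t) (f x) (f y) = prec t x y.
Proof.
move=> f_inj; rewrite /prec filter_map -[[:: f x; f y]]/(map f [:: x; y]).
rewrite (inj_eq (inj_map f_inj)); congr (_ == _).
by apply: eq_filter => z /=; rewrite !(inj_eq f_inj).
Qed.

Lemma filter_pred2 t x y : uniq t -> x \notin t ->
  filter (pred2 x y) t = if y \in t then [:: y] else [::].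
Proof.
move=> ut xt; rewrite (eq_in_filter (a2 := pred1 y)); last first.
  by move=> z zt /=; case: eqP => // e; rewrite -e zt in xt.
case: ifP => yt; first by rewrite filter_pred1_uniq.
by apply/eqP; rewrite -size_eq0 size_filter; apply/eqP/count_memPn; rewrite yt.
Qed.

Lemma prec_cat t1 t2 x y : uniq (t1 ++ x :: t2) -> x != y ->
  prec (t1 ++ x :: t2) x y = (y \in t2).
Proof.
rewrite cat_uniq /= => /and3P[u1 /norP[x1 h12] /andP[x2 u2]] xy.
rewrite /prec filter_cat /= eqxx /= !filter_pred2 //.
case: ifP => y1; case: ifP => y2 //=; rewrite ?eqxx //.
- by case/hasP: h12; exists y.
- by rewrite eq_sym in xy; rewrite eqseq_cons (negPf xy).
- by rewrite eqseq_cons andbF.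
Qed.

Lemma prec_asym t x y : uniq t -> x != y -> x \in t -> y \in t ->
  prec t x y = ~~ prec t y x.
Proof.
move=> ut xy /[dup] xt /path.splitPr e yt; case: e ut yt => t1 t2 ut yt.
rewrite prec_cat // -prec_rev rev_cat rev_cons cat_rcons prec_cat //; last first.
  by rewrite -cat_rcons -rev_cons -rev_cat rev_uniq.
move: ut yt; rewrite mem_cat inE mem_rev cat_uniq eq_sym (negPf xy) /=.
case/and3P=> _ /norP[_ /hasPn h] _; case: (boolP (y \in t2)) => [/h /negPf -> //|_].
by rewrite orbF => ->.
Qed.

End Prec.

(* The maximal run x, x + 1, ..., up t x of consecutive integers that occur in
   this order in t. *)
Definition chain (t : seq nat) (x : nat) : nat :=
  foldl (fun y i => if i == y.+1 then i else y) x t.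

Definition up (t : seq nat) (x : nat) : nat := chain (drop (index x t).+1 t) x.

Lemma chain_id t x : x.+1 \notin t -> chain t x = x.
Proof.
elim: t => //= i t IH; rewrite inE => /norP[]; rewrite eq_sym => /negPf ->; exact: IH.
Qed.

Lemma up_cat t1 t2 x : x \notin t1 -> up (t1 ++ x :: t2) x = chain t2 x.
Proof.
move=> x1; rewrite /up index_cat (negPf x1) /= eqxx addn0.
by rewrite drop_cat ltnNge leqnSn /= subSnn /= drop0.
Qed.

(** Each step of the run moves to a later entry of [t], so strong induction on the length of the
    remaining suffix applies, with the entries already passed absorbed into the prefix. *)
Lemma up_spec t x : uniq t -> x \in t ->
  [/\ x <= up t x, up t x \in t, ~~ prec t (up t x) (up t x).+1
    & forall y, x <= y < up t x -> prec t y y.+1].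
Proof.
move=> ut /[dup] xt /path.splitPr e; case: e ut xt => t1 t2 ut xt.
have x1 : x \notin t1 by move: ut; rewrite cat_uniq => /and3P[_ /norP[]].
rewrite (up_cat _ x1).
have [n] := ubnP (size t2); elim: n x t1 t2 ut {xt x1} => // n IH x t1 t2 ut sz.
have [xt|xt] := boolP (x.+1 \in t2); last first.
  rewrite chain_id // prec_cat ?xt ?mem_cat ?inE ?eqxx ?orbT ?ltn_eqF //.
  by split=> // y; lia.
have pr : prec (t1 ++ x :: t2) x x.+1 by rewrite prec_cat // ltn_eqF.
move: ut sz pr; case/path.splitPr: xt => t3 t4 ut sz pr.
have ut' : uniq ((t1 ++ x :: t3) ++ x.+1 :: t4) by rewrite -catA.
have sz' : size t4 < n by move: sz; rewrite size_cat /=; lia.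
have := IH _ _ _ ut' sz'; rewrite -catA /= => -[h1 h2 h3 h4].
have x3 : x.+1 \notin t3.
  by move: ut'; rewrite cat_uniq => /and3P[_ /norP[+ _] _]; rewrite mem_cat inE !negb_or => /and3P[].
rewrite /chain foldl_cat -/(chain t3 x) (chain_id x3) /= eqxx -/(chain t4 x.+1).
split=> //; first lia.
by move=> y; case: (eqVneq y x) => [-> //|] ?; move=> ?; apply: h4; lia.
Qed.

(* For t = q and z + k these are the indices x such that (t, x) violates the SIP
   (see SIP_colbody); colbody (rev t) plays the same role for (x, t). *)
Definition colbody (t : seq nat) (x : nat) : bool :=
  (x \in t) && ~~ prec t x x.+1.

Lemma colbody_rev t x : colbody (rev t) x = (x \in t) && ~~ prec t x.+1 x.
Proof. by rewrite /colbody mem_rev prec_rev. Qed.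

Lemma colbody_up t x : uniq t -> x \in t -> colbody t (up t x).
Proof. by move=> ut xt; have [_ h1 h2 _] := up_spec ut xt; apply/andP. Qed.

(** When [b e] holds, this is the 0-based rank of [e] among the positions satisfying [b]. *)
Definition bodycnt (b : nat -> bool) (e : nat) : nat := \sum_(i < e) b i.

Lemma bodycntS b e : bodycnt b e.+1 = bodycnt b e + b e.
Proof. by rewrite /bodycnt big_ord_recr. Qed.

Lemma bodycnt_const b c e : c <= e -> (forall i, c <= i < e -> ~~ b i) ->
  bodycnt b c = bodycnt b e.
Proof.
elim: e => [|e IH]; first by rewrite leqn0 => /eqP->.
rewrite leq_eqVlt => /orP[/eqP -> //|ce h].
rewrite bodycntS (negPf (h e _)) ?addn0; last lia.
by apply: IH => // i ?; apply: h; lia.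
Qed.

Lemma bodycntC b e : bodycnt (fun i => ~~ b i) e + bodycnt b e = e.
Proof.
elim: e => [|e IH]; first by rewrite /bodycnt !big_ord0.
by rewrite !bodycntS; move: IH; case: (b e) => /=; lia.
Qed.

Lemma bodycnt_lt (b : nat -> bool) i j : i < j -> b i -> bodycnt b i < bodycnt b j.
Proof.
elim: j => // j IH; rewrite ltnS leq_eqVlt bodycntS => /orP[/eqP -> -> |ij bi].
  by rewrite addn1.
by rewrite ltn_addr // IH.
Qed.

Lemma bodycnt_inj (b : nat -> bool) i j : b i -> b j -> bodycnt b i = bodycnt b j -> i = j.
Proof.
by move=> bi bj e; have [lt|lt|] := ltngtP i j => //; [have := bodycnt_lt lt bi | have := bodycnt_lt lt bj]; rewrite e ltnn.
Qed.

(* Lists the body indices first and the wing indices last, each in increasing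
   order. *)
Definition bodypos (b : nat -> bool) (k j : nat) : nat :=
  if b j then bodycnt b j else bodycnt b k + bodycnt (fun i => ~~ b i) j.

Lemma bodypos_lt b k j : j < k -> bodypos b k j < k.
Proof.
rewrite /bodypos => jk; case: ifP => bj.
  by apply: leq_trans (bodycnt_lt jk bj) _; have := bodycntC b k; lia.
have := bodycntC b k; have := @bodycnt_lt (fun i => ~~ b i) _ _ jk (negbT bj); lia.
Qed.

Lemma bodypos_wing b k j : j < k -> (bodycnt b k <= bodypos b k j) = ~~ b j.
Proof.
rewrite /bodypos => jk; case: ifP => bj /=; last by rewrite leq_addr.
by have := bodycnt_lt jk bj; lia.
Qed.

Lemma bodypos_inj b k i j : i < k -> j < k -> bodypos b k i = bodypos b k j -> i = j.
Proof.
move=> ik jk e.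
have bij : b i = b j.
  by apply: negb_inj; rewrite -(bodypos_wing b ik) -(bodypos_wing b jk) e.
move: e; rewrite /bodypos bij; case: ifP => bj e; first by apply: bodycnt_inj e; rewrite ?bij.
by apply: (@bodycnt_inj (fun i => ~~ b i)) (addnI e); rewrite ?bij bj.
Qed.

(** The sorting map is the inverse of [r], because block-column [j] moves to position [r^-1 j] under
    right multiplication by the block-permutation matrix. *)
Lemma bodypos_perm b k :
  exists r : 'S_k, forall j : 'I_k, (r^-1)%g j = bodypos b k j :> nat.
Proof.
pose f (j : 'I_k) := Ordinal (bodypos_lt b (ltn_ord j)).
have f_inj : injective f.
  by move=> i j /(congr1 val) /= /bodypos_inj e; apply: val_inj; apply: e.
by exists (perm f_inj)^-1%g => j; rewrite invgK permE.
Qed.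

(** * Body and wing positions *)

(* Block positions j are 0-based.  Q lists q, and Z lists z + k, so that the
   index i is at i in Q or at k - i in Z; position j sits between the indices
   k - j - 1 and k - j. *)
Section Pair.
Variables (k : nat).
Implicit Types Q Z : seq nat.

Definition pair_wf Q Z :=
  [/\ uniq Q, uniq Z, {in Q, forall i, i < k}, {in Z, forall i, i < k}
    & forall i, i <= k -> (i \in Q) = (k - i \notin Z)].

(** Position [j] is a body block-column as soon as one of the two coefficients has more than an
    identity there; with both tuples reversed it describes body block-rows. *)
Definition bodyb Q Z (j : nat) : bool :=
  colbody Q (k - j.+1) || colbody Z j.

Lemma pair_wf_rev Q Z : pair_wf Q Z -> pair_wf (rev Q) (rev Z).
Proof.
case=> h1 h2 h3 h4 h5; split; rewrite ?rev_uniq // => i; rewrite ?mem_rev.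
- exact: h3.
- exact: h4.
- exact: h5.
Qed.

(** Position [j] lies between the indices [k - j - 1] and [k - j]. If both are in C_0 or both in
    C_1, their order makes [j] a body position for exactly one of rows and columns. If only
    [k - j - 1] is in C_0 it is one for both, and if only [k - j] is, for neither. *)
Lemma bodyb_sum Q Z j : pair_wf Q Z -> j < k ->
  bodyb Q Z j + bodyb (rev Q) (rev Z) j + (j \notin Z) = 1 + (j.+1 \notin Z).
Proof.
case=> uQ uZ kQ kZ QZ jk.
have e1 : (k - j.+1 \in Q) = (j.+1 \notin Z) by rewrite QZ ?leq_subr // subKn.
have e2 : ((k - j.+1).+1 \in Q) = (j \notin Z) by rewrite subnSK // QZ ?leq_subr // subKn // ltnW.
rewrite /bodyb !colbody_rev /colbody.
have aQ := @prec_asym _ Q (k - j.+1) (k - j.+1).+1 uQ.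
have aZ := @prec_asym _ Z j j.+1 uZ.
have mQ1 := @prec_mem _ Q (k - j.+1) (k - j.+1).+1.
have mQ2 := @prec_mem _ Q (k - j.+1).+1 (k - j.+1).
have mZ1 := @prec_mem _ Z j j.+1.
have mZ2 := @prec_mem _ Z j.+1 j.
move: aQ aZ mQ1 mQ2 mZ1 mZ2; rewrite e1 e2 !ltn_eqF //.
move: (j \in Z) (j.+1 \in Z) (prec Z j j.+1) (prec Z j.+1 j).
move: (prec Q (k - j.+1) (k - j.+1).+1) (prec Q (k - j.+1).+1 (k - j.+1)).
by move=> [] [] [] [] [] [] //=; rewrite /is_true; intuition congruence.
Qed.

(** Telescopes [bodyb_sum], starting from [0 \in Z], which holds because the index [k] is not in
    [Q]. *)
Lemma bodycnt_sum Q Z e : pair_wf Q Z -> e <= k ->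
  bodycnt (bodyb (rev Q) (rev Z)) e + bodycnt (bodyb Q Z) e = e + (e \notin Z).
Proof.
move=> wf; elim: e => [_|e IH ek].
  case: wf => _ _ kQ _ QZ; rewrite /bodycnt !big_ord0.
  by have := QZ _ (leqnn k); rewrite subnn; case: (0 \in Z) => // /kQ; rewrite ltnn.
by rewrite !bodycntS; have := bodyb_sum wf ek; have := IH (ltnW ek); lia.
Qed.

(** Along the run every consecutive pair is in order in [Z], so the positions before its end are
    wing block-columns: the run ends at the first body block-column at or after [e]. *)
Lemma bodycnt_upZ Q Z e : pair_wf Q Z -> e \in Z ->
  bodyb Q Z (up Z e) /\ bodycnt (bodyb Q Z) (up Z e) = bodycnt (bodyb Q Z) e.
Proof.
case=> uQ uZ kQ kZ QZ eZ; have [le _ _ pr] := up_spec uZ eZ.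
split; first by rewrite /bodyb colbody_up ?orbT.
apply/esym/bodycnt_const => // i /pr piZ; have /andP[iZ i1Z] := prec_mem piZ.
rewrite /bodyb /colbody piZ andbF orbF negb_and QZ ?leq_subr // subKn ?i1Z //.
exact: kZ.
Qed.

(** Runs in [Q] go up in index, hence down in position: the run of [x] ends at the last body
    block-column before position [k - x]. *)
Lemma bodycnt_upQ Q Z x : pair_wf Q Z -> x \in Q ->
  bodyb Q Z (k - (up Q x).+1) /\
  (bodycnt (bodyb Q Z) (k - (up Q x).+1)).+1 = bodycnt (bodyb Q Z) (k - x).
Proof.
case=> uQ uZ kQ kZ QZ xQ; have [le yQ _ pr] := up_spec uQ xQ.
have yk := kQ _ yQ; set j := k - _.
have ej : k - j.+1 = up Q x by rewrite /j; lia.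
have bj : bodyb Q Z j by rewrite /bodyb ej colbody_up.
split=> //; have -> : (bodycnt (bodyb Q Z) j).+1 = bodycnt (bodyb Q Z) j.+1.
  by rewrite bodycntS bj addn1.
apply: bodycnt_const => [|i ij]; first by rewrite /j; lia.
have /pr pi : x <= k - i.+1 < up Q x by move: ij; rewrite /j; lia.
have /andP[iQ i1Q] := prec_mem pi.
rewrite /bodyb /colbody pi andbF /= negb_and.
by move: i1Q; rewrite subnSK ?QZ ?leq_subr ?subKn ?subn_gt0 => [-> //|||]; lia.
Qed.

(* In a wing block-row j the entries -I_n and lambda I_n are in the block-columns
   wsrc Q j and wtgt Z j. *)
Definition wsrc Q j := if k - j \in Q then k - (up Q (k - j)).+1 else j.
Definition wtgt Z j := if j.+1 \in Z then up Z j.+1 else j.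

(** By [bodycnt_sum], the number [w] of wing rows before [j] is the number of body columns before
    [j], less one when [j] is not in [Z]; the ends of the two runs then have ranks [w] and [w + 1].
    The case of [j] in [Z] and [j + 1] outside is excluded, as it makes row [j] a body row. *)
Lemma wing_spec Q Z j : pair_wf Q Z -> j < k -> ~~ bodyb (rev Q) (rev Z) j ->
  let w := bodycnt (fun i => ~~ bodyb (rev Q) (rev Z) i) j in
  [/\ bodyb Q Z (wsrc Q j), bodyb Q Z (wtgt Z j),
      bodycnt (bodyb Q Z) (wsrc Q j) = w & bodycnt (bodyb Q Z) (wtgt Z j) = w.+1].
Proof.
move=> wf jk bj w.
have := bodyb_sum wf jk; rewrite (negPf bj) addn0 => sj.
have := bodycnt_sum wf (ltnW jk); have := bodycntC (bodyb (rev Q) (rev Z)) j.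
rewrite -/w => cw cs.
have [_ _ _ _ QZ] := wf.
have eQ : (k - j \in Q) = (j \notin Z) by rewrite QZ ?leq_subr // subKn // ltnW.
rewrite /wsrc /wtgt eQ.
have [jZ|jZ] := boolP (j \in Z); have [j1Z|j1Z] := boolP (j.+1 \in Z);
  move: sj cs; rewrite ?jZ ?j1Z ?(negPf jZ) ?(negPf j1Z) /= => sj cs.
- have bj1 : bodyb Q Z j by move: sj; case: bodyb.
  have [-> ->] := bodycnt_upZ wf j1Z; rewrite bodycntS bj1; split=> //; lia.
- by move: sj; case: bodyb.
- have bj1 : bodyb Q Z j = false by move: sj; case: bodyb.
  have /(bodycnt_upQ wf)[] : k - j \in Q by rewrite eQ jZ.
  have -> : k - (k - j) = j by lia.
  have [-> ->] := bodycnt_upZ wf j1Z; rewrite bodycntS bj1 => -> ?; split=> //; lia.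
- have bj1 : bodyb Q Z j by move: sj; case: bodyb.
  have /(bodycnt_upQ wf)[] : k - j \in Q by rewrite eQ jZ.
  have -> : k - (k - j) = j by lia.
  move=> -> ?; rewrite bj1; split=> //; lia.
Qed.

End Pair.

Local Open Scope ring_scope.

(** * Products of elementary matrices *)

Section TensorSum.
Variables (R : comPzRingType) (m n p q : nat).
Implicit Types (A : 'M[R]_(m, n)) (B : 'M[R]_(p, q)).

Lemma tensmxDl A1 A2 B : (A1 + A2) *t B = A1 *t B + A2 *t B.
Proof. by apply/matrixP=> i j; rewrite !mxE mulrDl. Qed.

End TensorSum.

Lemma tensmx11 (R : comPzRingType) (m n : nat) :
  (1%:M : 'M[R]_m) *t (1%:M : 'M[R]_n) = 1%:M.
Proof.
apply/matrixP=> i j.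
case: (mxtens_indexP i) => a b; case: (mxtens_indexP j) => c e.
by rewrite tensmxE !mxE -natrM mulnb (can_eq (@mxtens_indexK m n)).
Qed.

(* phi numbers the block positions from the bottom for the M_i, and from the top
   for the M_-i with i replaced by k - i; both families then have the same
   shape, elem_tens below. *)
Section Positions.
Variables (F : fieldType) (k : nat) (phi : 'I_k -> nat).
Hypothesis phi_inj : injective phi.
Hypothesis phi_lt : forall u, (phi u < k)%N.

Lemma phi_surj x : (x < k)%N -> exists u, phi u = x.
Proof.
move=> xk; pose f u := Ordinal (phi_lt u).
have f_inj : injective f by move=> u v /(congr1 val) /= /phi_inj.
exists (invF f_inj (Ordinal xk)).
by have /(congr1 val) := f_invF f_inj (Ordinal xk).
Qed.

(** The basis row of the position with label [x]; it is zero when no position carries that label. *)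
Definition unit_row (x : nat) : 'rV[F]_k := \row_v (phi v == x)%:R.
Local Notation d := unit_row.

(** For [i > 0] this exchanges the positions labelled [i - 1] and [i]. For [i = 0] it is the
    identity with its diagonal entry at label 0 replaced by zero, which serves M_0 and M_-k. *)
Definition swap_mx (i : nat) : 'M[F]_k :=
  \matrix_(u, v) [|| (phi u == i) && ((phi v).+1 == i),
                     ((phi u).+1 == i) && (phi v == i)
                   | [&& phi u == phi v, phi u != i & (phi u).+1 != i]]%:R.

Definition corner_mx (i : nat) : 'M[F]_k := (d i)^T *m d i.

Lemma swap_mx_tr i : (swap_mx i)^T = swap_mx i.
Proof.
apply/matrixP=> u v; rewrite !mxE; congr (nat_of_bool _)%:R.
by rewrite !(eq_sym (phi v)) /=; case: (eqVneq (phi u) (phi v)) => [->|]; lia.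
Qed.

Lemma unit_row_mul u (A : 'M[F]_k) : d (phi u) *m A = row u A.
Proof.
rewrite rowE; congr (_ *m _); apply/rowP=> v.
by rewrite !mxE (inj_eq phi_inj).
Qed.

Lemma unit_row_swap x i : (x < k)%N ->
  d x *m swap_mx i =
    if x == i then (if x is y.+1 then d y else 0)
    else if x.+1 == i then d i else d x.
Proof.
case/phi_surj=> u <-; rewrite unit_row_mul; apply/rowP=> v; rewrite !mxE.
case: (eqVneq (phi u) i) => [<-|ne] /=.
  rewrite (gtn_eqF (ltnSn _)) andbF !orbF.
  by case: (phi u) => [|y]; rewrite mxE.
case: eqP => [<-|_] /=; rewrite mxE ?andbF ?orbF // andbT.
by rewrite eq_sym.
Qed.

Lemma unit_row_dot x y : (x < k)%N -> d x *m (d y)^T = (x == y)%:R%:M.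
Proof.
case/phi_surj=> u <-; apply/matrixP=> i j; rewrite !ord1 !mxE (bigD1 u) //=.
rewrite !mxE eqxx mul1r big1 ?addr0 ?mulr1n // => v vu.
by rewrite !mxE (inj_eq phi_inj) (negPf vu) mul0r.
Qed.

Fixpoint swap_prod (t : seq nat) : 'M[F]_k :=
  if t is i :: t' then swap_mx i *m swap_prod t' else 1%:M.
Local Notation W := swap_prod.

Lemma swap_prod_cat t1 t2 : W (t1 ++ t2) = W t1 *m W t2.
Proof. by elim: t1 => [|i t1 IH] /=; rewrite ?mul1mx // IH mulmxA. Qed.

Lemma swap_prod_rev t : W (rev t) = (W t)^T.
Proof.
elim: t => [|i t IH] /=; first by rewrite trmx1.
by rewrite rev_cons -cats1 swap_prod_cat IH /= mulmx1 trmx_mul swap_mx_tr.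
Qed.

Implicit Types t : seq nat.

(** From a label absent from the tuple, only the factor [x + 1] can act on the row, and it moves the
    row up. The new label has then been used up, so the situation repeats. *)
Lemma unit_row_chain t x : uniq t -> {in t, forall i, i < k}%N ->
  (x < k)%N -> x \notin t -> d x *m W t = d (chain t x).
Proof.
elim: t x => [|i t IH] x /=; first by rewrite mulmx1.
case/andP=> it ut tk xk; rewrite inE => /norP[/negPf xi xt].
have tk' : {in t, forall i, i < k}%N by move=> j jt; rewrite tk // inE jt orbT.
rewrite mulmxA unit_row_swap // xi eq_sym.
by case: (eqVneq i) => [e|_]; rewrite IH // tk // inE eqxx.
Qed.

(** Since [x] does not come before [x + 1], the first factor acting on the row is [x + 1], if
    present; after that a factor [x] no longer touches it. *)
Lemma unit_row_wing t x : uniq t -> {in t, forall i, i < k}%N ->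
  (x < k)%N -> ~~ colbody (rev t) x ->
  d x *m W t = d (if x.+1 \in t then up t x.+1 else x).
Proof.
move=> ut tk xk; rewrite colbody_rev negb_and negbK => xt.
case: ifP => x1t; last first.
  have x0 : x \notin t by case/orP: xt => // /prec_mem; rewrite x1t.
  by rewrite unit_row_chain // chain_id ?x1t.
case/path.splitPr: x1t ut tk xt => t1 t2 ut tk xt.
have ut' := ut; move: ut'; rewrite cat_uniq => /and3P[u1 /norP[x1 h12] /andP[x2 u2]].
have tk1 : {in t1, forall i, i < k}%N by move=> j jt; rewrite tk // mem_cat jt.
have tk2 : {in t2, forall i, i < k}%N by move=> j jt; rewrite tk // mem_cat inE jt !orbT.
have x1k : (x.+1 < k)%N by rewrite tk // mem_cat inE eqxx orbT.
have x0 : x \notin t1.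
  case/orP: xt => [|]; first by rewrite mem_cat => /norP[].
  by rewrite prec_cat ?gtn_eqF // => /(hasPn h12).
rewrite up_cat // swap_prod_cat /= mulmxA unit_row_chain // chain_id //.
by rewrite mulmxA unit_row_swap // ltn_eqF // eqxx unit_row_chain.
Qed.

(** The first factor acting on the row is [x] itself, which moves it down. It cannot rise again,
    since the index that moved it to [y] was [y + 1]. It vanishes below 0 or stops at a [y] that
    does not follow [y + 1] in [t], a wing column label. *)
Lemma unit_row_body t x : uniq t -> {in t, forall i, i < k}%N ->
  colbody (rev t) x -> d x *m W t = 0 \/
  exists2 y, ~~ colbody t y & d x *m W t = d y.
Proof.
move=> ut tk; rewrite colbody_rev => /andP[xt nx].
case/path.splitPr: xt ut tk nx => t1 t2 ut tk nx.
have ut' := ut; move: ut'; rewrite cat_uniq => /and3P[u1 /norP[x1 h12] /andP[x2 u2]].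
have tk1 : {in t1, forall i, i < k}%N by move=> j jt; rewrite tk // mem_cat jt.
have xk : (x < k)%N by rewrite tk // mem_cat inE eqxx orbT.
have x10 : x.+1 \notin t1.
  apply: contra nx => x1t; rewrite -prec_rev rev_cat rev_cons cat_rcons.
  by rewrite prec_cat ?ltn_eqF ?mem_rev // -cat_rcons -rev_cons -rev_cat rev_uniq.
have -> : d x *m W (t1 ++ x :: t2) = (if x is y.+1 then d y else 0) *m W t2.
  by rewrite swap_prod_cat /= mulmxA unit_row_chain // chain_id // mulmxA unit_row_swap // eqxx.
(* Only the descent remains: the row is at [x - 1], or is zero if [x = 0], with [t2] still to be
   applied. Each induction step on [x] enlarges the prefix. *)
clear nx x1 u1 tk1 u2 x2 h12 x10.
elim: x t1 t2 ut tk xk => [|x IH] t1 t2 ut tk xk; first by left; rewrite mul0mx.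
have ut' := ut; move: ut'; rewrite cat_uniq => /and3P[u1 /norP[x1 h12] /andP[x2 u2]].
have tk2 : {in t2, forall i, i < k}%N by move=> j jt; rewrite tk // mem_cat inE jt !orbT.
have [xt|xt] := boolP (x \in t2); last first.
  right; exists x; last by rewrite unit_row_chain ?(ltnW xk) // chain_id.
  rewrite negb_and negbK mem_cat inE ltn_eqF // (negPf xt) !orbF -implybE.
  apply/implyP=> xt1; rewrite -prec_rev rev_cat rev_cons cat_rcons.
  by rewrite prec_cat ?gtn_eqF ?mem_rev // -cat_rcons -rev_cons -rev_cat rev_uniq.
case/path.splitPr: xt ut tk x2 u2 tk2 {h12} => t3 t4 ut tk x2 u2 tk2.
have := IH (t1 ++ x.+1 :: t3) t4; rewrite -catA /= => /(_ ut tk (ltnW xk)).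
move: u2 x2; rewrite -/(uniq _) cat_uniq mem_cat => /and3P[u3 /norP[x3 _] _] /norP[x13 _].
have tk3 : {in t3, forall i, i < k}%N by move=> j jt; rewrite tk2 // mem_cat jt.
rewrite swap_prod_cat /= !mulmxA (unit_row_chain _ _ (ltnW xk)) // chain_id //.
by rewrite unit_row_swap ?(ltnW xk) // eqxx.
Qed.

Lemma swap_prod_body t u v : uniq t -> {in t, forall i, i < k}%N ->
  colbody (rev t) (phi u) -> colbody t (phi v) -> W t u v = 0.
Proof.
move=> ut tk bu bv.
have -> : W t u v = (d (phi u) *m W t) 0 v by rewrite unit_row_mul mxE.
case: (unit_row_body ut tk bu) => [->|[y by_ ->]]; rewrite !mxE //.
by case: eqP => // e; rewrite -e bv in by_.
Qed.

Definition elem_tens n (i : nat) (B : 'M[F]_n) : 'M[F]_(k * n) :=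
  swap_mx i *t 1%:M + corner_mx i *t B.

Lemma up_cons i t x : i != x -> up (i :: t) x = up t x.
Proof. by rewrite /up /= => /negPf ->. Qed.

Lemma up_rcons i t x : x \in t ->
  up (rcons t i) x = if i == (up t x).+1 then i else up t x.
Proof.
move=> xt; rewrite /up -cats1 index_cat xt drop_cat ltn_neqAle index_mem xt andbT.
case: eqP => [e|_]; last by rewrite /chain foldl_cat.
by rewrite e drop_size subnn.
Qed.

(* No product B i *m B j appears: row i of the product of the swaps strictly
   between i and j in t has its 1 at i or at one of the swapped indices, hence
   not at j. *)
Lemma prod_elem_tens n (B : nat -> 'M[F]_n) t :
  uniq t -> {in t, forall i, i < k}%N ->
  \prod_(i <- t) elem_tens i (B i) =
  W t *t 1%:M + \sum_(s <- t) ((d (up (rev t) s))^T *m d (up t s)) *t B s.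
Proof.
elim: t => [|i t IH]; first by rewrite !big_nil addr0 /= tensmx11.
move=> /= /andP[it ut] tk.
have ik : (i < k)%N by rewrite tk // inE eqxx.
have tk' : {in t, forall i, i < k}%N by move=> j jt; rewrite tk // inE jt orbT.
rewrite !big_cons IH // -[_ * _]/(_ *m _) mulmxDr !mulmxDl !tensmx_mul !mulmx1.
rewrite -addrA; congr (_ + (_ + _)).
  rewrite /corner_mx -mulmxA unit_row_chain //.
  by rewrite rev_cons -cats1 up_cat ?mem_rev // -[i :: t]cat0s up_cat.
rewrite !mulmx_sumr -big_split /=; apply: eq_big_seq => s st.
have si : i != s by apply: contraNneq it => ->.
rewrite !tensmx_mul up_cons // rev_cons up_rcons ?mem_rev //.
set y := up (rev t) s.
have yt : y \in t.
  by rewrite -mem_rev; have [] := @up_spec (rev t) s; rewrite ?rev_uniq ?mem_rev.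
have iy : i != y by apply: contraNneq it => ->.
rewrite /corner_mx -!mulmxA [d i *m _]mulmxA unit_row_dot // (negPf iy) mul_scalar_mx.
rewrite scale0r mulmx0 tens0mx addr0 mul1mx mulmxA; congr (_ *m _ *t _).
apply: trmx_inj; rewrite trmx_mul swap_mx_tr !trmxK unit_row_swap ?tk' //.
by rewrite eq_sym (negPf iy) eq_sym; case: eqP.
Qed.

End Positions.

(** * Entries of the elementary matrices *)

Section ElementaryMatrices.
Variables (F : fieldType) (n k : nat).
Implicit Types (B X Y : 'M[F]_n) (u v : 'I_k) (a b : 'I_n).

Lemma conform_mxE m m' (D : 'M[F]_m') (A : 'M[F]_m) (e : m' = m) i j :
  conform_mx D A i j = A (cast_ord e i) (cast_ord e j).
Proof. by subst m'; rewrite conform_mx_id !cast_ord_id. Qed.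

Lemma mxtens_index_eq r (i j : 'I_r) a b :
  (mxtens_index (i, a) == mxtens_index (j, b)) = (i == j) && (a == b).
Proof. by rewrite (can_eq (@mxtens_indexK r n)). Qed.

Lemma dsum_topE c B u v a b : k = c.+1 ->
  conform_mx (1%:M : 'M_(k * n)) (dsum B (1%:M : 'M_(c * n)))
    (mxtens_index (u, a)) (mxtens_index (v, b)) =
  if (u == 0 :> nat) && (v == 0 :> nat) then B a b else ((u == v) && (a == b))%:R.
Proof.
move=> ek; have e : (k * n = n + c * n)%N by rewrite ek mulSn.
have idx u' a' : (exists2 w : 'I_c, u' = w.+1 :> nat &
      cast_ord e (mxtens_index (u', a')) = rshift _ (mxtens_index (w, a'))) \/
    (u' = 0%N :> nat /\ cast_ord e (mxtens_index (u', a')) = lshift _ a').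
  case: (posnP u') => [u0|u0]; [right; split=> // | left].
    by apply: val_inj => /=; rewrite u0 mul0n.
  have h : (u'.-1 < c)%N by have := ltn_ord u'; lia.
  exists (Ordinal h); first by rewrite /= prednK.
  by apply: val_inj => /=; rewrite addnA -mulSn prednK.
rewrite (conform_mxE _ _ e) /dsum -(inj_eq (@ord_inj k) u v).
have [[w1 -> ->]|[-> ->]] := idx u a; have [[w2 -> ->]|[-> ->]] := idx v b;
  by rewrite ?(block_mxEul, block_mxEur, block_mxEdl, block_mxEdr) ?mxE
      ?mxtens_index_eq ?eqSS ?(inj_eq (@ord_inj _)).
Qed.

Lemma dsum_botE c B u v a b : k = c.+1 ->
  conform_mx (1%:M : 'M_(k * n)) (dsum (1%:M : 'M_(c * n)) B)
    (mxtens_index (u, a)) (mxtens_index (v, b)) =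
  if (u == c :> nat) && (v == c :> nat) then B a b else ((u == v) && (a == b))%:R.
Proof.
move=> ek; have e : (k * n = c * n + n)%N by rewrite ek mulSn addnC.
have idx u' a' : (exists2 w : 'I_c, u' = w :> nat &
      cast_ord e (mxtens_index (u', a')) = lshift _ (mxtens_index (w, a'))) \/
    (u' = c :> nat /\ cast_ord e (mxtens_index (u', a')) = rshift _ a').
  case: (eqVneq (u' : nat) c) => u0; [right; split=> // | left].
    by apply: val_inj => /=; rewrite u0.
  have h : (u' < c)%N by have := ltn_ord u'; lia.
  by exists (Ordinal h) => //; apply: val_inj.
rewrite (conform_mxE _ _ e) /dsum -(inj_eq (@ord_inj k) u v).
have [[w1 -> ->]|[-> ->]] := idx u a; have [[w2 -> ->]|[-> ->]] := idx v b;
  by rewrite ?(block_mxEul, block_mxEur, block_mxEdl, block_mxEdr) ?mxE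
      ?mxtens_index_eq ?eqxx ?(ltn_eqF (ltn_ord _)) ?(gtn_eqF (ltn_ord _)) ?(inj_eq (@ord_inj _)).
Qed.

Lemma dsum_midE c c' X Y u v a b : k = (c + c'.+2)%N ->
  conform_mx (1%:M : 'M_(k * n))
    (dsum (1%:M : 'M_(c * n))
       (dsum (block_mx X 1%:M 1%:M Y) (1%:M : 'M_(c' * n))))
    (mxtens_index (u, a)) (mxtens_index (v, b)) =
  if (u == c :> nat) && (v == c :> nat) then X a b
  else if (u == c.+1 :> nat) && (v == c.+1 :> nat) then Y a b
  else ([|| (u == c :> nat) && (v == c.+1 :> nat),
            (u == c.+1 :> nat) && (v == c :> nat) | u == v] && (a == b))%:R.
Proof.
move=> ek; have e : (k * n = c * n + ((n + n) + c' * n))%N by rewrite ek; lia.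
have idx u' a' : [\/ (exists2 w : 'I_c, u' = w :> nat &
      cast_ord e (mxtens_index (u', a')) = lshift _ (mxtens_index (w, a'))),
    (u' = c :> nat /\ cast_ord e (mxtens_index (u', a')) = rshift _ (lshift _ (lshift _ a'))),
    (u' = c.+1 :> nat /\ cast_ord e (mxtens_index (u', a')) = rshift _ (lshift _ (rshift _ a')))
    | (exists2 w : 'I_c', u' = (c + w).+2 :> nat &
      cast_ord e (mxtens_index (u', a')) = rshift _ (rshift _ (mxtens_index (w, a'))))].
  have [lt|gt|eqc] := ltngtP u' c.
  - by constructor 1; exists (Ordinal lt) => //; apply: val_inj.
  - have [eqc|ne] := eqVneq (u' : nat) c.+1.
      constructor 3; split=> //; apply: val_inj => /=.
      by rewrite eqc; lia.
    have h : (u' - c.+2 < c')%N by have := ltn_ord u'; lia.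
    constructor 4; exists (Ordinal h); first by rewrite /=; lia.
    apply: val_inj => /=; have -> : (u' = c.+2 + (u' - c.+2) :> nat)%N by lia.
    by rewrite addKn; lia.
  - by constructor 2; split=> //; apply: val_inj => /=; rewrite eqc.
have cS : (c == c.+1) = false by rewrite ltn_eqF.
have ltc (w : 'I_c) : ((w : nat) == c) = false by rewrite ltn_eqF.
have ltc1 (w : 'I_c) : ((w : nat) == c.+1) = false by rewrite ltn_eqF // ltnW // ltnS.
have gtc (w : nat) : ((c + w).+2 == c) = false by lia.
have gtc1 (w : nat) : ((c + w).+2 == c.+1) = false by lia.
have ltgt (w1 : 'I_c) (w2 : nat) : ((w1 : nat) == (c + w2).+2) = false.
  by have := ltn_ord w1; lia.
rewrite (conform_mxE _ _ e) /dsum -(inj_eq (@ord_inj k) u v).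
have [[w1 -> ->]|[-> ->]|[-> ->]|[w1 -> ->]] := idx u a;
have [[w2 -> ->]|[-> ->]|[-> ->]|[w2 -> ->]] := idx v b;
  by rewrite ?(block_mxEul, block_mxEur, block_mxEdl, block_mxEdr) ?mxE
      ?mxtens_index_eq ?eqxx ?[c.+1 == c]eq_sym ?[c == nat_of_ord _]eq_sym
      ?[c.+1 == nat_of_ord _]eq_sym ?[(c + _).+2 == nat_of_ord _]eq_sym
      ?[c == (c + _).+2]eq_sym ?[c.+1 == (c + _).+2]eq_sym
      ?(cS, ltc, ltc1, gtc, gtc1, ltgt) ?eqSS ?eqn_add2l ?(inj_eq (@ord_inj _)) ?andbF //=.
Qed.

Lemma elem_tensE (phi : 'I_k -> nat) i B u v a b :
  injective phi ->
  elem_tens phi i B (mxtens_index (u, a)) (mxtens_index (v, b)) =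
  if (phi u == i) && (phi v == i) then B a b
  else ([|| (phi u == i) && ((phi v).+1 == i), ((phi u).+1 == i) && (phi v == i)
          | [&& u == v, phi u != i & (phi u).+1 != i]] && (a == b))%:R.
Proof.
move=> phi_inj; rewrite /elem_tens mxE !tensmxE -(inj_eq phi_inj u v) !mxE.
rewrite big_ord1 !mxE -!natrM !mulnb.
case: (eqVneq (phi u) i) => [->|ui] /=; last by rewrite mul0r addr0.
case: (eqVneq (phi v) i) => [->|vi] /=; last by rewrite mul0r addr0.
by rewrite (gtn_eqF (ltnSn i)) mulr0n mul1r add0r.
Qed.

Definition revpos (u : 'I_k) : nat := (k - u.+1)%N.

Lemma revpos_inj : injective revpos.
Proof.
by move=> u v; rewrite /revpos => e; apply: val_inj => /=; have := ltn_ord u; have := ltn_ord v; lia.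
Qed.

Lemma revpos_lt u : (revpos u < k)%N.
Proof. by have := ltn_ord u; rewrite /revpos; lia. Qed.

Lemma elem_mx_pos i B : (i < k)%N ->
  elem_mx k i%:Z B = elem_tens revpos i B.
Proof.
move=> ik; apply/matrixP=> r s.
case: (mxtens_indexP r) => u a; case: (mxtens_indexP s) => v b.
rewrite (elem_tensE _ _ _ _ _ _ revpos_inj) -(inj_eq (@ord_inj k) u v) /revpos.
have := ltn_ord u; have := ltn_ord v => vk uk.
case: i ik => [|i] ik.
  rewrite /elem_mx (dsum_botE _ _ _ _ _ (_ : k = (k - 1).+1)); last lia.
  rewrite -(inj_eq (@ord_inj k) u v) /=.
  have -> : (u == (k - 1)%N :> nat) = ((k - u.+1)%N == 0%N) by lia.
  have -> : (v == (k - 1)%N :> nat) = ((k - v.+1)%N == 0%N) by lia.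
  by case: ifP => // h; congr (nat_of_bool (_ && _))%:R; lia.
rewrite /elem_mx (dsum_midE _ _ _ _ _ _ (_ : k = (k - i.+1 - 1 + (i.+1 - 1).+2)%N)); last lia.
rewrite -(inj_eq (@ord_inj k) u v) /= mxE.
have -> : (u == (k - i.+1 - 1)%N :> nat) = ((k - u.+1)%N == i.+1) by lia.
have -> : (v == (k - i.+1 - 1)%N :> nat) = ((k - v.+1)%N == i.+1) by lia.
have -> : (u == (k - i.+1 - 1).+1 :> nat) = ((k - u.+1).+1 == i.+1) by lia.
have -> : (v == (k - i.+1 - 1).+1 :> nat) = ((k - v.+1).+1 == i.+1) by lia.
case: ifP => // h; case: ifP => [h2|h2]; [rewrite -[0 in LHS]/(false%:R)|];
  by congr (nat_of_bool _)%:R; rewrite -?[LHS]/(false && (a == b)); congr (_ && _); lia.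
Qed.

Lemma elem_mx_neg i B : (i < k)%N ->
  elem_mx k (Negz i) B = elem_tens val (k - i.+1) B.
Proof.
move=> ik; apply/matrixP=> r s.
case: (mxtens_indexP r) => u a; case: (mxtens_indexP s) => v b.
rewrite (elem_tensE _ _ _ _ _ _ val_inj) -(inj_eq (@ord_inj k) u v).
have := ltn_ord u; have := ltn_ord v => vk uk.
(* [Negz i] is the index [-(i + 1)]. When it is [-k], the block sits in the top position, whose
   label is 0. *)
rewrite /elem_mx; case: eqP => [ek|ne].
  rewrite (dsum_topE _ _ _ _ _ (_ : k = (k - 1).+1)); last lia.
  rewrite -(inj_eq (@ord_inj k) u v) /= ek subnn.
  by case: ifP => // h; congr (nat_of_bool (_ && _))%:R; lia.
rewrite (dsum_midE _ _ _ _ _ _ (_ : k = (k - i.+1 - 1 + (i.+1 - 1).+2)%N)); last lia.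
rewrite -(inj_eq (@ord_inj k) u v) /= mxE.
have -> : (u == (k - i.+1 - 1)%N :> nat) = (u.+1 == (k - i.+1)%N) by lia.
have -> : (v == (k - i.+1 - 1)%N :> nat) = (v.+1 == (k - i.+1)%N) by lia.
have -> : (u == (k - i.+1 - 1).+1 :> nat) = (u == (k - i.+1)%N :> nat) by lia.
have -> : (v == (k - i.+1 - 1).+1 :> nat) = (v == (k - i.+1)%N :> nat) by lia.
case: ifP => h.
  have -> : (u == (k - i.+1)%N :> nat) = false by lia.
  rewrite -[0]/(false%:R); congr (nat_of_bool _)%:R.
  by rewrite -[LHS]/(false && (a == b)); congr (_ && _); lia.
by case: ifP => // h2; congr (nat_of_bool (_ && _))%:R; lia.
Qed.

End ElementaryMatrices.

(** * Block-rows and block-columns of the two coefficients *)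

Section ProductBlocks.
Variables (F : fieldType) (n k : nat) (phi : 'I_k -> nat).
Hypothesis phi_inj : injective phi.
Hypothesis phi_lt : forall u, (phi u < k)%N.
Variables (t : seq nat) (B : nat -> 'M[F]_n).
Hypothesis ut : uniq t.
Hypothesis tk : {in t, forall i, i < k}%N.

Lemma blk_prod u v :
  blk (\prod_(i <- t) elem_tens phi i (B i)) u v =
  (swap_prod F phi t u v)%:M +
  \sum_(s <- t) ((phi u == up (rev t) s) && (phi v == up t s))%:R *: B s.
Proof.
apply/matrixP=> a b; rewrite prod_elem_tens // /blk mxE mxE tensmxE !mxE summxE.
rewrite summxE mulr_natr; congr (_ + _); apply: eq_bigr => s _.
by rewrite tensmxE !mxE big_ord1 !mxE -natrM mulnb.
Qed.

(** Every coefficient block lies in a row with label [up (rev t) s], a body label by [colbody_up]; a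
    wing row therefore sees the swaps alone. *)
Lemma blk_prod_row u v : ~~ colbody (rev t) (phi u) ->
  blk (\prod_(i <- t) elem_tens phi i (B i)) u v =
  (phi v == if (phi u).+1 \in t then up t (phi u).+1 else phi u)%:R%:M.
Proof.
move=> wu; rewrite blk_prod big1_seq ?addr0 => [|s /= st].
  have -> : swap_prod F phi t u v = (unit_row F phi (phi u) *m swap_prod F phi t) 0 v.
    by rewrite unit_row_mul // mxE.
  by rewrite unit_row_wing // mxE.
case: eqP => [e|_]; last by rewrite scale0r.
by rewrite e colbody_up ?rev_uniq ?mem_rev in wu.
Qed.

End ProductBlocks.

(** Transposition: reversing the tuple transposes the product of swaps and exchanges the two
    coordinates of each block. *)
Lemma blk_prod_col (F : fieldType) (n k : nat) (phi : 'I_k -> nat) (t : seq nat)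
    (B : nat -> 'M[F]_n) u v :
  injective phi -> (forall u, phi u < k)%N -> uniq t -> {in t, forall i, i < k}%N ->
  ~~ colbody t (phi v) ->
  blk (\prod_(i <- t) elem_tens phi i (B i)) u v =
  (phi u == if (phi v).+1 \in t then up (rev t) (phi v).+1 else phi v)%:R%:M.
Proof.
move=> phi_inj phi_lt ut tk wv.
have utr : uniq (rev t) by rewrite rev_uniq.
have tkr : {in rev t, forall i, i < k}%N by move=> i; rewrite mem_rev; apply: tk.
rewrite -(mem_rev t) -(blk_prod_row phi_inj phi_lt B utr tkr) ?revK //.
rewrite !blk_prod // swap_prod_rev mxE revK; congr (_ + _).
by rewrite big_rev; apply: eq_bigr => s _; rewrite andbC.
Qed.

Section GFPBlocks.
Variables (F : fieldType) (n k : nat) (A : nat -> 'M[F]_n).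
Implicit Types (Q Z : seq nat) (u v : 'I_k).

Definition prodQ Q : 'M[F]_(k * n) :=
  \prod_(i <- Q) elem_tens (@revpos k) i (- A i).
Definition prodZ Z : 'M[F]_(k * n) :=
  \prod_(e <- Z) elem_tens val e (A (k - e)).

Lemma revpos_eq v y : (y < k)%N -> (revpos v == y) = (v == (k - y.+1)%N :> nat).
Proof. by move=> yk; rewrite /revpos; have := ltn_ord v; lia. Qed.

Lemma revposS u : (revpos u).+1 = (k - u)%N.
Proof. by rewrite /revpos; have := ltn_ord u; lia. Qed.

Lemma wsrc_lt Q Z u : pair_wf k Q Z -> (wsrc k Q u < k)%N.
Proof.
by case=> uQ _ kQ _ _; rewrite /wsrc; case: ifP => // h; have := ltn_ord u; lia.
Qed.

Lemma wtgt_lt Q Z u : pair_wf k Q Z -> (wtgt Z u < k)%N.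
Proof.
case=> _ uZ _ kZ _; rewrite /wtgt; case: ifP => // h.
by apply: kZ; have [] := up_spec uZ h.
Qed.

Lemma blkQ_row Q Z u v : pair_wf k Q Z -> ~~ bodyb k (rev Q) (rev Z) u ->
  blk (prodQ Q) u v = (v == wsrc k Q u :> nat)%:R%:M.
Proof.
case=> uQ uZ kQ kZ QZ /norP[wQ _].
rewrite blk_prod_row // ?revposS; [|exact: revpos_inj|exact: revpos_lt].
rewrite /wsrc; case: ifP => h; rewrite revpos_eq ?revpos_lt //.
- by apply: kQ; have [] := up_spec uQ h.
- by rewrite revposS subKn // ltnW.
Qed.

Lemma blkZ_row Q Z u v : pair_wf k Q Z -> ~~ bodyb k (rev Q) (rev Z) u ->
  blk (prodZ Z) u v = (v == wtgt Z u :> nat)%:R%:M.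
Proof.
case=> uQ uZ kQ kZ QZ /norP[_ wZ].
exact: (blk_prod_row val_inj (@ltn_ord k)).
Qed.

Lemma blkQ_col Q Z u v : pair_wf k Q Z -> ~~ bodyb k Q Z v ->
  blk (prodQ Q) u v = (u == wsrc k (rev Q) v :> nat)%:R%:M.
Proof.
case=> uQ uZ kQ kZ QZ /norP[wQ _].
rewrite blk_prod_col // ?revposS; [|exact: revpos_inj|exact: revpos_lt].
rewrite /wsrc mem_rev; case: ifP => h; rewrite revpos_eq ?revpos_lt //.
- have [] := @up_spec (rev Q) (k - v)%N; rewrite ?rev_uniq ?mem_rev // => _ h' _ _.
  exact: kQ.
- by rewrite revposS subKn // ltnW.
Qed.

Lemma blkZ_col Q Z u v : pair_wf k Q Z -> ~~ bodyb k Q Z v ->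
  blk (prodZ Z) u v = (u == wtgt (rev Z) v :> nat)%:R%:M.
Proof.
case=> uQ uZ kQ kZ QZ /norP[_ wZ].
by rewrite (blk_prod_col _ _ val_inj (@ltn_ord k)) // /wtgt mem_rev.
Qed.

Lemma both_body Q Z j : pair_wf k Q Z -> (j < k)%N ->
  bodyb k (rev Q) (rev Z) j -> bodyb k Q Z j -> (j \in Z) && (j.+1 \notin Z).
Proof.
move=> wf jk b1 b2; have := bodyb_sum wf jk; rewrite b1 b2.
by case: (j \in Z); case: (j.+1 \in Z).
Qed.

(** Here [u] is a body row because of [Z] only, so [k - u] is not in [Q] and the identity of row [u]
    stays on the diagonal. If [v = u], then [both_body] puts [k - u - 1] in [Q], and with [k - u]
    absent this makes the row a body row for [Q] too, a contradiction. *)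
Lemma swapQ_body_row Q Z u v : pair_wf k Q Z ->
  bodyb k (rev Q) (rev Z) u -> bodyb k Q Z v ->
  ~~ colbody (rev Q) (k - u.+1) -> swap_prod F (@revpos k) Q u v = 0.
Proof.
move=> wf bu bv wu; case: (wf) => uQ uZ kQ kZ QZ.
have := bu; rewrite /bodyb (negPf wu) /= colbody_rev => /andP[uZ' _].
have kuQ : (k - u)%N \in Q = false by rewrite QZ ?leq_subr // subKn ?uZ' // ltnW.
have -> : swap_prod F (@revpos k) Q u v =
    (unit_row F (@revpos k) (revpos u) *m swap_prod F (@revpos k) Q) 0 v.
  by rewrite unit_row_mul ?mxE //; apply: revpos_inj.
rewrite unit_row_wing //; [|exact: revpos_inj|exact: revpos_lt|exact: revpos_lt].
rewrite revposS kuQ mxE (inj_eq (@revpos_inj k)); case: eqP => // e.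
rewrite e in bv; have /andP[_ u1] := both_body wf (ltn_ord u) bu bv.
move: wu; rewrite colbody_rev negb_and negbK QZ ?leq_subr // subKn // u1 /=.
by case/prec_mem/andP; rewrite subnSK ?kuQ.
Qed.

Lemma swapZ_body_row Q Z u v : pair_wf k Q Z ->
  bodyb k (rev Q) (rev Z) u -> bodyb k Q Z v ->
  ~~ colbody (rev Z) u -> swap_prod F val Z u v = 0.
Proof.
move=> wf bu bv wu; case: (wf) => uQ uZ kQ kZ QZ.
have := bu; rewrite /bodyb (negPf wu) orbF colbody_rev => /andP[uQ' _].
have u1Z : u.+1 \notin Z by move: uQ'; rewrite QZ ?leq_subr // subKn.
have -> : swap_prod F val Z u v = (unit_row F val (val u) *m swap_prod F val Z) 0 v.
  by rewrite (unit_row_mul val_inj) mxE.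
rewrite (unit_row_wing _ val_inj (@ltn_ord k) uZ kZ (ltn_ord u) wu).
rewrite (negPf u1Z) mxE (inj_eq val_inj); case: eqP => // e.
rewrite e in bv; have /andP[u0 _] := both_body wf (ltn_ord u) bu bv.
move: wu; rewrite colbody_rev negb_and negbK u0 /=.
by case/prec_mem/andP; rewrite (negPf u1Z).
Qed.

(** If [Q] makes both the row and the column body positions, the descent of [unit_row_body] applies.
    Otherwise the diagonal argument of [swapQ_body_row] does, after transposing if the column is the
    exceptional one. *)
Lemma swapQ_body Q Z u v : pair_wf k Q Z ->
  bodyb k (rev Q) (rev Z) u -> bodyb k Q Z v -> swap_prod F (@revpos k) Q u v = 0.
Proof.
move=> wf bu bv; case: (wf) => uQ uZ kQ kZ QZ.
have [cu|] := boolP (colbody (rev Q) (revpos u)); last exact: swapQ_body_row bv.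
have [cv|cv] := boolP (colbody Q (revpos v)).
  by apply: swap_prod_body => //; [exact: revpos_inj|exact: revpos_lt].
have := swapQ_body_row (pair_wf_rev wf) (u := v) (v := u).
by rewrite !revK swap_prod_rev mxE; apply.
Qed.

Lemma swapZ_body Q Z u v : pair_wf k Q Z ->
  bodyb k (rev Q) (rev Z) u -> bodyb k Q Z v -> swap_prod F val Z u v = 0.
Proof.
move=> wf bu bv; case: (wf) => uQ uZ kQ kZ QZ.
have [cu|] := boolP (colbody (rev Z) u); last exact: swapZ_body_row bv.
have [cv|cv] := boolP (colbody Z v).
  exact: (swap_prod_body _ val_inj (@ltn_ord k)).
have := swapZ_body_row (pair_wf_rev wf) (u := v) (v := u).
by rewrite !revK swap_prod_rev mxE; apply.
Qed.

End GFPBlocks.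

(** * Permuting to block Kronecker form *)

Section BlockPermutations.
Variables (R : comPzRingType) (n k : nat).
Implicit Types (X Y : 'M[R]_(k * n)) (l r : 'S_k) (i j : 'I_k).

Lemma blk_mul X Y i j : blk (X *m Y) i j = \sum_h blk X i h *m blk Y h j.
Proof.
apply/matrixP=> a b; rewrite /blk !mxE summxE.
under [RHS]eq_bigr => h _ do rewrite !mxE.
rewrite pair_big /= (reindex (@mxtens_index k n)) /=; last first.
  exists (@mxtens_unindex k n) => ? _; [exact: mxtens_indexK|exact: mxtens_unindexK].
by apply: eq_bigr => -[h c] _; rewrite !mxE.
Qed.

Lemma blk_block_perm r i j : blk (block_perm_mx R n r) i j = (i == r j)%:R%:M.
Proof.
by apply/matrixP=> a b; rewrite mxE tensmxE !mxE; case: (a == b); rewrite ?mulr1 ?mulr0.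
Qed.

Lemma blk_block_trmx X i j : blk (block_trmx X) i j = blk X j i.
Proof. by apply/matrixP=> a b; rewrite /block_trmx !mxE !mxtens_indexK. Qed.

Lemma blk_permr X r i j : blk (X *m block_perm_mx R n r) i j = blk X i (r j).
Proof.
rewrite blk_mul (bigD1 (r j)) //= blk_block_perm eqxx mulmx1 big1 ?addr0 // => h hj.
by rewrite blk_block_perm (negPf hj) mul_mx_scalar scale0r.
Qed.

Lemma blk_perml X l i j :
  blk (block_trmx (block_perm_mx R n l) *m X) i j = blk X (l i) j.
Proof.
rewrite blk_mul (bigD1 (l i)) //= blk_block_trmx blk_block_perm eqxx mul1mx.
rewrite big1 ?addr0 // => h hj.
by rewrite blk_block_trmx blk_block_perm (negPf hj) mul_scalar_mx scale0r.
Qed.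

End BlockPermutations.

Lemma bodypos_perm_eq k (b : nat -> bool) (r : 'S_k) (j : 'I_k) y :
  (forall j : 'I_k, (r^-1)%g j = bodypos b k j :> nat) ->
  (y < k)%N -> b y -> (r j == y :> nat) = (j == bodycnt b y :> nat).
Proof.
move=> hr yk b_y; have := hr (Ordinal yk); rewrite /bodypos /= b_y => <-.
by rewrite -[y]/(val (Ordinal yk)) !val_eqE -(inj_eq (@perm_inj _ r^-1)%g) permK.
Qed.

Lemma bodypos_perm_id k (b : nat -> bool) (r : 'S_k) (j : 'I_k) :
  (forall j : 'I_k, (r^-1)%g j = bodypos b k j :> nat) -> bodypos b k (r j) = j.
Proof. by move=> hr; rewrite -hr permK. Qed.

Lemma blk_pencil (F : fieldType) n k (A1 A0 : 'M[F]_(k * n)) i j :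
  blk (pencil A1 A0) i j =
  'X *: map_mx polyC (blk A1 i j) + map_mx polyC (blk A0 i j).
Proof. by apply/matrixP=> a b; rewrite !mxE. Qed.

Lemma has_grade_pencil (F : fieldType) n k (A1 A0 : 'M[F]_(k * n)) :
  has_grade 1 (pencil A1 A0).
Proof.
move=> i j; rewrite !mxE; apply/leq_sizeP => -[|[|m]] // _.
by rewrite coefD coefXM !coefC addr0.
Qed.

(** Turns the sum along a block antidiagonal into a sum over indices, each index [s] contributing
    its block at the single place [(Nr s, Nc s)]. *)
Lemma sum_deltas q p c (t : seq nat) (Nr Nc : nat -> nat)
    (F : fieldType) (n : nat) (B : nat -> 'M[F]_n) :
  {in t, forall s, Nr s < q.+1 /\ Nc s < p.+1}%N ->
  \sum_(i < q.+1) \sum_(j < p.+1 | (i.+1 + j.+1 == c)%N)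
     \sum_(s <- t) ((i == Nr s :> nat) && (j == Nc s :> nat))%:R *: B s =
  \sum_(s <- t | ((Nr s).+1 + (Nc s).+1 == c)%N) B s.
Proof.
move=> lt; under eq_bigr do rewrite exchange_big /=.
rewrite exchange_big [RHS]big_mkcond; apply: eq_big_seq => s /lt[lr lc] /=.
rewrite (bigD1 (Ordinal lr)) //= big_mkcond (bigD1 (Ordinal lc)) //= !eqxx scale1r.
rewrite !big1 ?addr0 // => [i ne|j ne].
  rewrite big1 // => j _; case: eqP => [e|_]; last by rewrite scale0r.
  by case/eqP: ne; apply: val_inj.
case: ifP => // _; case: eqP => [e|_]; last by rewrite scale0r.
by case/eqP: ne; apply: val_inj.
Qed.

Lemma big_seq_eq (V : nmodType) (t : seq nat) x (G : nat -> V) : uniq t ->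
  \sum_(s <- t | s == x) G s = if x \in t then G x else 0.
Proof.
move=> ut; case: ifP => xt; last first.
  by rewrite big1_seq // => s /andP[/eqP-> ]; rewrite xt.
by rewrite -big_filter filter_pred1_uniq // big_seq1.
Qed.

(** * Body, wings and AS condition of the permuted pencil *)

Section Assembly.
Variables (F : fieldType) (n k p q : nat) (A : nat -> 'M[F]_n) (Q Z : seq nat).
Implicit Types (u v : 'I_k).
Hypothesis wf : pair_wf k Q Z.
Hypothesis ek : k = (p + q + 1)%N.
Local Notation cb := (bodyb k Q Z).
Local Notation rb := (bodyb k (rev Q) (rev Z)).
Hypothesis ep : p.+1 = bodycnt cb k.
Hypothesis eqr : q.+1 = bodycnt rb k.
Variables (l r : 'S_k).
Hypothesis hr : forall j : 'I_k, (r^-1)%g j = bodypos cb k j :> nat.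
Hypothesis hl : forall j : 'I_k, (l^-1)%g j = bodypos rb k j :> nat.

Let K := pencil (prodZ k A Z) (- prodQ k A Q).
Let Pil := block_trmx (block_perm_mx {poly F} n l).
Let Pir := block_perm_mx {poly F} n r.
Let L := Pil *m K *m Pir.

Let er : (q.+1 + p = k)%N. Proof. by rewrite ek; lia. Qed.
Let ec : (p.+1 + q = k)%N. Proof. by rewrite ek; lia. Qed.
Let brow (i : 'I_q.+1) : 'I_k := cast_ord er (lshift p i).
Let wrow (i : 'I_p) : 'I_k := cast_ord er (rshift q.+1 i).
Let bcol (j : 'I_p.+1) : 'I_k := cast_ord ec (lshift q j).
Let wcol (j : 'I_q) : 'I_k := cast_ord ec (rshift p.+1 j).

Lemma wing_row_pos (u : 'I_k) : ~~ rb u ->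
  ((l^-1)%g u = q.+1 + bodycnt (fun i => ~~ rb i) u :> nat)%N.
Proof. by move=> bu; rewrite hl /bodypos (negPf bu) eqr. Qed.

Lemma wing_col_pos (v : 'I_k) : ~~ cb v ->
  ((r^-1)%g v = p.+1 + bodycnt (fun i => ~~ cb i) v :> nat)%N.
Proof. by move=> bv; rewrite hr /bodypos (negPf bv) ep. Qed.

Lemma blkK u v :
  blk K u v = 'X *: map_mx polyC (blk (prodZ k A Z) u v)
              - map_mx polyC (blk (prodQ k A Q) u v).
Proof. by rewrite blk_pencil; apply/matrixP=> a b; rewrite !mxE polyCN. Qed.

Lemma wing_row_blk u j : ~~ rb u ->
  let w := bodycnt (fun i => ~~ rb i) u in
  blk K u (r j) = ((j == w.+1 :> nat)%:R * 'X - (j == w :> nat)%:R)%:M.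
Proof.
move=> bu w; rewrite blkK (blkZ_row _ _ wf) // (blkQ_row _ _ wf) //.
have [b1 b2 c1 c2] := wing_spec wf (ltn_ord u) bu.
rewrite (bodypos_perm_eq _ hr (wsrc_lt _ wf) b1) (bodypos_perm_eq _ hr (wtgt_lt _ wf) b2).
rewrite c1 c2 -/w; apply/matrixP=> a b; rewrite !mxE.
by case: (a == b); rewrite ?mulr1n ?mulr0n ?polyC0 ?mulr0 ?subrr // !polyC_natr mulrC.
Qed.

Lemma wing_col_blk v i : ~~ cb v ->
  let w := bodycnt (fun i => ~~ cb i) v in
  blk K (l i) v = ((i == w.+1 :> nat)%:R * 'X - (i == w :> nat)%:R)%:M.
Proof.
move=> bv w; rewrite blkK (blkZ_col _ _ wf) // (blkQ_col _ _ wf) //.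
(* Reversing both tuples exchanges the roles of block-rows and block-columns. *)
have wf' := pair_wf_rev wf; have := wing_spec wf' (ltn_ord v).
rewrite !revK => /(_ bv)[b1 b2 c1 c2].
rewrite (bodypos_perm_eq _ hl (wsrc_lt _ wf') b1) (bodypos_perm_eq _ hl (wtgt_lt _ wf') b2).
rewrite c1 c2 -/w; apply/matrixP=> a b; rewrite !mxE.
by case: (a == b); rewrite ?mulr1n ?mulr0n ?polyC0 ?mulr0 ?subrr // !polyC_natr mulrC.
Qed.

Lemma body_row (i : 'I_k) : rb (l i) = (i < q.+1)%N.
Proof.
by rewrite -[in RHS](bodypos_perm_id i hl) ltnNge eqr bodypos_wing // negbK.
Qed.

Lemma body_col (j : 'I_k) : cb (r j) = (j < p.+1)%N.
Proof.
by rewrite -[in RHS](bodypos_perm_id j hr) ltnNge ep bodypos_wing // negbK.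
Qed.

Lemma blkL i j : blk L i j = blk K (l i) (r j).
Proof. by rewrite blk_permr blk_perml. Qed.

Lemma castmx_rowE (e : (k * n = q.+1 * n + p * n)%N) (i : 'I_q.+1) a :
  cast_ord (esym e) (lshift _ (mxtens_index (i, a))) = mxtens_index (brow i, a).
Proof. exact: val_inj. Qed.

Lemma castmx_wrowE (e : (k * n = q.+1 * n + p * n)%N) (i : 'I_p) a :
  cast_ord (esym e) (rshift _ (mxtens_index (i, a))) = mxtens_index (wrow i, a).
Proof. by apply: val_inj; rewrite /= mulnDl addnA. Qed.

Lemma castmx_colE (e : (k * n = p.+1 * n + q * n)%N) (i : 'I_p.+1) a :
  cast_ord (esym e) (lshift _ (mxtens_index (i, a))) = mxtens_index (bcol i, a).
Proof. exact: val_inj. Qed.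

Lemma castmx_wcolE (e : (k * n = p.+1 * n + q * n)%N) (i : 'I_q) a :
  cast_ord (esym e) (rshift _ (mxtens_index (i, a))) = mxtens_index (wcol i, a).
Proof. by apply: val_inj; rewrite /= mulnDl addnA. Qed.

Lemma blkE (X : 'M[{poly F}]_(k * n)) i j a b :
  X (mxtens_index (i, a)) (mxtens_index (j, b)) = blk X i j a b.
Proof. by rewrite mxE. Qed.

Definition body : 'M[{poly F}]_(q.+1 * n, p.+1 * n) :=
  blockmx (fun i j => blk L (brow i) (bcol j)).

Lemma wrow_pos (i : 'I_p) :
  ~~ rb (l (wrow i)) /\ bodycnt (fun i => ~~ rb i) (l (wrow i)) = i.
Proof.
have b : ~~ rb (l (wrow i)) by rewrite body_row -leqNgt /= leq_addr.
split=> //; have := wing_row_pos b; rewrite permK /= => /addnI e; exact/esym.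
Qed.

Lemma wcol_pos (i : 'I_q) :
  ~~ cb (r (wcol i)) /\ bodycnt (fun i => ~~ cb i) (r (wcol i)) = i.
Proof.
have b : ~~ cb (r (wcol i)) by rewrite body_col -leqNgt /= leq_addr.
split=> //; have := wing_col_pos b; rewrite permK /= => /addnI e; exact/esym.
Qed.

Lemma body_is_block_kronecker : is_block_kronecker L body.
Proof.
split.
  move=> i j; case: (mxtens_indexP i) => u a; case: (mxtens_indexP j) => v b.
  rewrite mxE !mxtens_indexK /= blkL mxE; exact: has_grade_pencil.
exists ek; rewrite -[LHS]submxK; congr block_mx; apply/matrixP=> i j;
  case: (mxtens_indexP i) => u a; case: (mxtens_indexP j) => v b;
  rewrite mxE [LHS]mxE castmxE ?castmx_rowE ?castmx_wrowE ?castmx_colE ?castmx_wcolE.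
- by rewrite [RHS]mxE !mxtens_indexK blkE.
- have [bv wv] := wcol_pos v.
  rewrite tensmxE blkE blkL (wing_col_blk _ bv) wv !mxE /=.
  case: (a == b); rewrite ?mulr0 ?mulr0n // mulr1 mulr1n.
  case: (eqVneq (u : nat) v) => [->|_]; first by rewrite ltn_eqF // mul0r sub0r.
  by case: eqP => _; rewrite ?mul1r ?mul0r subr0.
- have [bu wu] := wrow_pos u.
  rewrite tensmxE blkE blkL (wing_row_blk _ bu) wu !mxE /=.
  case: (a == b); rewrite ?mulr0 ?mulr0n // mulr1 mulr1n.
  case: (eqVneq (v : nat) u) => [->|_]; first by rewrite ltn_eqF // mul0r sub0r.
  by case: eqP => _; rewrite ?mul1r ?mul0r subr0.
(* Wing block-row [u] is nonzero only in the block-columns [u] and [u + 1], which are at most [p]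
   and so precede every wing block-column. *)
- have [bu wu] := wrow_pos u; have [bv wv] := wcol_pos v.
  rewrite blkE blkL (wing_row_blk _ bu) wu !mxE /= !gtn_eqF ?mul0r ?subrr ?mul0rn //;
    by have := ltn_ord u; lia.
Qed.

Lemma coefmx_body s i j :
  blk (coefmx s body) i j = coefmx s (blk K (l (brow i)) (r (bcol j))).
Proof.
rewrite -blkL; apply/matrixP=> a b; rewrite [RHS]mxE [LHS]mxE [LHS]mxE.
by rewrite [X in (polyseq X)`_s = _]mxE !mxtens_indexK.
Qed.

Lemma rb_brow (i : 'I_q.+1) : rb (l (brow i)).
Proof. by rewrite body_row /=. Qed.

Lemma cb_bcol (i : 'I_p.+1) : cb (r (bcol i)).
Proof. by rewrite body_col /=. Qed.

Lemma body_row_eq (i : 'I_q.+1) y : (y < k)%N -> rb y ->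
  (l (brow i) == y :> nat) = (i == bodycnt rb y :> nat).
Proof. exact: bodypos_perm_eq hl. Qed.

Lemma body_col_eq (i : 'I_p.+1) y : (y < k)%N -> cb y ->
  (r (bcol i) == y :> nat) = (i == bodycnt cb y :> nat).
Proof. exact: bodypos_perm_eq hr. Qed.

(** By [swapZ_body] no identity is left in the body, and by [bodycnt_upZ] the end of each run has
    the rank counted at its start. *)
Lemma body_coef1 i j :
  blk (coefmx 1 body) i j = \sum_(e <- Z)
    ((i == bodycnt rb e :> nat) && (j == bodycnt cb e :> nat))%:R *: A (k - e).
Proof.
case: (wf) => uQ uZ kQ kZ QZ.
have -> : blk (coefmx 1 body) i j = blk (prodZ k A Z) (l (brow i)) (r (bcol j)).
  rewrite coefmx_body blkK; apply/matrixP=> a b.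
  by rewrite !mxE -polyCN coefD coefXM !coefC addr0.
rewrite (blk_prod val_inj (@ltn_ord k)) // (swapZ_body _ wf) ?rb_brow ?cb_bcol //.
rewrite raddf0 add0r; apply: eq_big_seq => e eZ; congr ((nat_of_bool (_ && _))%:R *: _).
  have [] := bodycnt_upZ (pair_wf_rev wf) (_ : e \in rev Z); first by rewrite mem_rev.
  move=> b <-; rewrite body_row_eq //; apply: kZ.
  by have [] := @up_spec (rev Z) e; rewrite ?rev_uniq ?mem_rev.
have [b <-] := bodycnt_upZ wf eZ; rewrite body_col_eq //; apply: kZ.
by have [] := up_spec uZ eZ.
Qed.

(** The run of [s] ends at the last body position before [k - s], so its rank is one less than the
    count there; that count is positive, so [.-1] is exact. The sign of [- A s] cancels that of the
    constant term of the pencil. *)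
Lemma body_coef0 i j :
  blk (coefmx 0 body) i j = \sum_(s <- Q)
    ((i == (bodycnt rb (k - s)).-1 :> nat) && (j == (bodycnt cb (k - s)).-1 :> nat))%:R *: A s.
Proof.
case: (wf) => uQ uZ kQ kZ QZ.
have -> : blk (coefmx 0 body) i j = - blk (prodQ k A Q) (l (brow i)) (r (bcol j)).
  rewrite coefmx_body blkK; apply/matrixP=> a b.
  by rewrite !mxE -polyCN coefD coefXM add0r coefC.
rewrite blk_prod //; [|exact: revpos_inj|exact: revpos_lt].
rewrite (swapQ_body _ wf) ?rb_brow ?cb_bcol //.
rewrite raddf0 add0r -sumrN; apply: eq_big_seq => s sQ.
rewrite scalerN opprK; congr ((nat_of_bool (_ && _))%:R *: _).
  have yk : (up (rev Q) s < k)%N.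
    by apply: kQ; have [] := @up_spec (rev Q) s; rewrite ?rev_uniq ?mem_rev.
  have [] := bodycnt_upQ (pair_wf_rev wf) (_ : s \in rev Q); first by rewrite mem_rev.
  by move=> b <-; rewrite revpos_eq // body_row_eq //; lia.
have yk : (up Q s < k)%N by apply: kQ; have [] := up_spec uQ sQ.
by have [b <-] := bodycnt_upQ wf sQ; rewrite revpos_eq // body_col_eq //; lia.
Qed.

(** By [bodycnt_sum], the 1-based coordinates of the block [A (k - e)] add up to [e + 2] for [e] in
    [Z], and those of [A s] to [k - s + 1] for [s] in [Q]. Each antidiagonal thus keeps at most the
    block of index [s], and exactly one of the two coefficients contains it. *)
Lemma AS_body s : (s <= k)%N -> AS body s = A s.
Proof.
move=> sk; case: (wf) => uQ uZ kQ kZ QZ; rewrite /AS /= -!ek.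
under eq_bigr do under eq_bigr do rewrite body_coef1.
under [X in _ + X]eq_bigr do under eq_bigr do rewrite body_coef0.
have bZ e : e \in Z -> [/\ (bodycnt rb e < q.+1)%N, (bodycnt cb e < p.+1)%N
    & (bodycnt rb e + bodycnt cb e = e)%N].
  move=> eZ; have := bodycnt_sum wf (ltnW (kZ _ eZ)); rewrite eZ addn0 => ->.
  have [b1 <-] := bodycnt_upZ wf eZ.
  have [] := bodycnt_upZ (pair_wf_rev wf) (_ : e \in rev Z); first by rewrite mem_rev.
  move=> b2 <-; rewrite eqr ep !bodycnt_lt //; apply: kZ.
    by have [] := up_spec uZ eZ.
  by have [] := @up_spec (rev Z) e; rewrite ?rev_uniq ?mem_rev.
have bQ i : i \in Q -> [/\ ((bodycnt rb (k - i)).-1 < q.+1)%N, ((bodycnt cb (k - i)).-1 < p.+1)%N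
    & ((bodycnt rb (k - i)).-1.+1 + (bodycnt cb (k - i)).-1.+1 = k - i + 1)%N].
  move=> iQ; have := bodycnt_sum wf (leq_subr i k).
  have -> : (k - i)%N \notin Z by rewrite -QZ // ltnW ?kQ.
  move=> <-.
  have [b1 <-] := bodycnt_upQ wf iQ.
  have [] := bodycnt_upQ (pair_wf_rev wf) (_ : i \in rev Q); first by rewrite mem_rev.
  move=> b2 <- /=; rewrite eqr ep !bodycnt_lt //; have := kQ _ iQ; lia.
rewrite !sum_deltas; first last.
- by move=> e /bZ[].
- by move=> e /bQ[].
rewrite big_seq_cond (eq_bigl (fun e => (e \in Z) && (e == k - s)%N)); last first.
  by move=> e; case: (boolP (e \in Z)) => //= /[dup] /kZ ek' /bZ[_ _ he]; rewrite addSn addnS he; lia.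
rewrite -big_seq_cond big_seq_eq // subKn //.
rewrite big_seq_cond (eq_bigl (fun e => (e \in Q) && (e == s)%N)); last first.
  by move=> e; case: (boolP (e \in Q)) => //= /[dup] /kQ ek' /bQ[_ _ he]; rewrite he; lia.
rewrite -big_seq_cond big_seq_eq // QZ //.
by case: (_ \in Z); rewrite ?addr0 ?add0r.
Qed.

Lemma mem_wing_cols j : (j \in wing_cols r p) = ~~ cb j.
Proof. by rewrite inE hr ep bodypos_wing. Qed.

Lemma mem_wing_rows j : (j \in wing_rows l q) = ~~ rb j.
Proof. by rewrite inE hl eqr bodypos_wing. Qed.

Lemma wing_col_form j : j \in wing_cols r p ->
  exists2 i : nat, (1 <= i <= q)%N &
    block_col (Pil *m K) j = - (ecol {poly F} k i *t (1%:M : 'M_n))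
                             + 'X *: (ecol {poly F} k i.+1 *t (1%:M : 'M_n)).
Proof.
rewrite mem_wing_cols => bj; set w := bodycnt (fun i => ~~ cb i) j.
(* [ecol] counts from 1 while the rank [w] counts from 0; the bound holds because the wing position
   [p + 1 + w] is below [k]. *)
exists w.+1.
  have := wing_col_pos bj; have := ltn_ord ((r^-1)%g j); rewrite -/w; lia.
apply/matrixP=> i i'; case: (mxtens_indexP i) => u a; case: (mxtens_indexP i') => v b.
rewrite mxE !mxtens_indexK /= blk_perml wing_col_blk // -/w !mxE !mxtens_indexK /=.
rewrite !eqSS; case: (a == b); rewrite ?mulr1n ?mulr0n ?mulr1 ?mulr0 ?subr0 ?oppr0 ?addr0 //.
by rewrite mulrC addrC.
Qed.

Lemma wing_row_form j : j \in wing_rows l q ->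
  exists2 i : nat, (1 <= i <= p)%N &
    block_row (K *m Pir) j = - ((ecol {poly F} k i)^T *t (1%:M : 'M_n))
                             + 'X *: ((ecol {poly F} k i.+1)^T *t (1%:M : 'M_n)).
Proof.
rewrite mem_wing_rows => bj; set w := bodycnt (fun i => ~~ rb i) j.
exists w.+1.
  have := wing_row_pos bj; have := ltn_ord ((l^-1)%g j); rewrite -/w; lia.
apply/matrixP=> i i'; case: (mxtens_indexP i) => u a; case: (mxtens_indexP i') => v b.
rewrite mxE !mxtens_indexK /= blk_permr wing_row_blk // -/w !mxE !mxtens_indexK /=.
rewrite !eqSS; case: (a == b); rewrite ?mulr1n ?mulr0n ?mulr1 ?mulr0 ?subr0 ?oppr0 ?addr0 //.
by rewrite mulrC addrC.
Qed.

End Assembly.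

Lemma prec_cat_mem (T : eqType) (s1 s2 : seq T) x y :
  uniq (s1 ++ s2) -> x \in s1 -> y \in s2 ->
  prec (s1 ++ s2) x y /\ ~~ prec (s1 ++ s2) y x.
Proof.
move=> us xs1 ys2; have xy : x != y.
  move: us; rewrite cat_uniq => /and3P[_ /hasPn h _].
  by apply: contraNneq (h _ ys2) => <-.
have pr : prec (s1 ++ s2) x y.
  case/path.splitPr: xs1 us => p1 p2; rewrite -catA /= => us.
  by rewrite prec_cat // mem_cat ys2 orbT.
by split=> //; rewrite -prec_asym // mem_cat ?xs1 ?ys2 ?orbT.
Qed.

Lemma prec_catr (T : eqType) (s1 s2 : seq T) x y :
  x \notin s1 -> y \notin s1 -> prec (s1 ++ s2) x y = prec s2 x y.
Proof.
move=> xs ys; rewrite /prec filter_cat (eq_in_filter (a2 := pred0)) ?filter_pred0 //.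
by move=> z zs /=; case: eqP => [e|_]; [rewrite -e zs in xs | case: eqP => // e; rewrite -e zs in ys].
Qed.

Lemma prec_catl (T : eqType) (s1 s2 : seq T) x y :
  x \notin s2 -> y \notin s2 -> prec (s1 ++ s2) x y = prec s1 x y.
Proof.
by move=> xs ys; rewrite -prec_rev rev_cat prec_catr ?mem_rev // prec_rev.
Qed.

(** * The SIP and column standard forms *)

Section SIPcriteria.
Implicit Types (t : seq int) (x : int).

(** In a tuple without repetitions the appended [x] can only repeat its one earlier occurrence, and
    an [x + 1] between the two is an [x + 1] after that occurrence. *)
Lemma SIP_rcons t x : uniq t ->
  SIP (t ++ [:: x]) <-> (x \in t -> prec t x (x + 1)).
Proof.
move=> ut; split=> [sip xt|pr a b].
  case/path.splitPr: xt ut sip => t1 t2 ut sip.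
  have [|/=|c] := sip (size t1) (size t1 + (size t2).+1)%N.
  - by rewrite !size_cat /=; lia.
  - by rewrite -catA !nth_cat ltnn subnn /= ltnNge leq_addr /= addKn /= ltnn subnn.
  move=> /andP[ac cb].
  rewrite -catA !nth_cat ltnn subnn /= ltnNge (ltnW ac) /= => e.
  rewrite prec_cat //; last by lia.
  rewrite -e; case ed: (c - size t1)%N => [|d] /=; first lia.
  by move: cb; rewrite -{1}(subnKC (ltnW ac)) ltn_add2l ed => h; rewrite h mem_nth.
rewrite size_cat addn1 ltnS => /andP[ab]; rewrite leq_eqVlt => /orP[/eqP eb|bt]; last first.
  rewrite !nth_cat bt (ltn_trans ab bt) => /eqP; rewrite nth_uniq // ?(ltn_trans ab bt) //; lia.
rewrite eb !nth_cat ltnn subnn -{1}eb ab /= => ea.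
have xt : x \in t by rewrite -ea mem_nth // -eb.
have ia : index x t = a by rewrite -ea index_uniq // -eb.
have /pr p := xt; case/path.splitPr: xt ut pr p ea eb ab ia => t1 t2 ut pr p ea eb ab ia.
have x1 : x \notin t1 by move: ut; rewrite cat_uniq => /and3P[_ /norP[]].
have at1 : a = size t1 by rewrite -ia index_cat (negPf x1) /= eqxx addn0.
move: p; rewrite prec_cat //; last lia.
move=> x1t; have it : (index (x + 1)%R t2 < size t2)%N by rewrite index_mem.
exists (size t1 + (index (x + 1)%R t2).+1)%N; first by rewrite at1 ?eb size_cat -{1}[size t1]addn0 !ltn_add2l.
rewrite -catA !nth_cat at1 ltnn subnn /= ltnNge leq_addr /= addKn /= ltnS it nth_index //.
by rewrite size_cat -[X in (X < _)%N]addn0 ltn_add2l.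
Qed.

Lemma SIP_rev t : SIP t -> SIP (rev t).
Proof.
move=> sip a b; rewrite size_rev => /andP[ab bs].
have as' := ltn_trans ab bs; rewrite !nth_rev // => e.
have [||c cab ec] := sip (size t - b.+1)%N (size t - a.+1)%N; [lia|by []|].
have cs : (c < size t)%N by case/andP: cab => _ /leq_trans; apply; apply: leq_subr.
exists (size t - c.+1)%N; last by rewrite nth_rev ?subnSK // ?leq_subr ?subKn 1?ltnW ?ec ?e.
by move: cab cs bs ab; move: (size t) => sz; lia.
Qed.

Lemma SIP_cons t x : uniq t ->
  SIP (x :: t) <-> (x \in t -> prec t (x + 1) x).
Proof.
move=> ut; rewrite -(prec_rev t x) -mem_rev -SIP_rcons ?rev_uniq //.
rewrite cats1 -rev_cons; split=> [|/SIP_rev]; first exact: SIP_rev.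
by rewrite revK.
Qed.

End SIPcriteria.

Section Strings.
Implicit Types (a b x : int).

Lemma stringE a m : string a (a + m%:Z - 1) = [seq a + i%:Z | i <- iota 0 m].
Proof.
rewrite /string; case: m => [|m].
  by case: ifP => //; lia.
by case: ifP => h; [congr map; congr iota; lia | lia].
Qed.

Lemma string_cat a x b : a <= x + 1 -> x <= b ->
  string a b = string a x ++ string (x + 1) b.
Proof.
move=> ax xb; pose m := absz (x + 1 - a)%R; pose m' := absz (b - x)%R.
have -> : b = a + (m + m')%N%:Z - 1 by rewrite /m /m'; lia.
have ex : x = a + m%:Z - 1 by rewrite /m; lia.
have -> : string a x = string a (a + m%:Z - 1) by rewrite -ex.
have -> : string (x + 1) (a + (m + m')%N%:Z - 1) = string (x + 1) (x + 1 + m'%:Z - 1).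
  by congr string; lia.
rewrite !stringE iotaD map_cat; congr (_ ++ _).
rewrite add0n -{1}[m]addn0 iotaDl -map_comp; apply: eq_map => i /=; lia.
Qed.

Lemma string1 a : string a a = [:: a].
Proof. by have := stringE a 1; rewrite addrK /= addr0. Qed.

Lemma mem_string a b x : (x \in string a b) = (a <= x <= b).
Proof.
rewrite /string; case: ifP => ab; last by rewrite in_nil; lia.
apply/mapP/idP => [[i]|h]; first by rewrite mem_iota => ? ->; lia.
by exists (absz (x - a)%R); rewrite ?mem_iota; lia.
Qed.

Lemma string_uniq a b : uniq (string a b).
Proof.
rewrite /string; case: ifP => // ab.
by rewrite map_inj_uniq ?iota_uniq // => i j; lia.
Qed.

Lemma string_prec a b x s : uniq (string a b ++ s) -> a <= x -> x < b ->
  prec (string a b ++ s) x (x + 1) /\ ~~ prec (string a b ++ s) (x + 1) x.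
Proof.
move=> us ax xb; have e : string a b = string a x ++ string (x + 1) b.
  by apply: string_cat; lia.
rewrite e -catA; apply: prec_cat_mem; rewrite ?catA -?e //.
  by rewrite mem_string; lia.
by rewrite mem_cat mem_string; apply/orP; left; lia.
Qed.

End Strings.

(** * Equivalence of tuples through the order of consecutive integers *)

Section Equivalence.
Implicit Types s t u v : seq int.

Lemma tuple_equiv_perm s t : tuple_equiv s t -> perm_eq s t.
Proof.
elim=> [//|u v w a b _ _ _]; apply: perm_trans.
by rewrite perm_cat2l -[a :: b :: v]/([:: a; b] ++ v) -[b :: a :: v]/([:: b; a] ++ v)
  perm_cat2r; apply/seq.permP => p /=; lia.
Qed.

(** An allowed interchange never involves two indices that differ by 1, so it leaves the subsequence
    of [x] and [y] unchanged. *)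
Lemma tuple_equiv_prec s t x y : `|x - y| = 1 -> tuple_equiv s t ->
  prec s x y = prec t x y.
Proof.
move=> xy; rewrite /prec => e; congr (_ == _); elim: e => // u v w a b ab ab1 _ <-.
rewrite !filter_cat /=; congr (_ ++ _).
by case: (boolP ((a == x) || (a == y))); case: (boolP ((b == x) || (b == y))) => //=; lia.
Qed.

Lemma tuple_equiv_trans s t u : tuple_equiv s t -> tuple_equiv t u -> tuple_equiv s u.
Proof. by elim=> // *; apply: tuple_equiv_swap; auto. Qed.

Lemma tuple_equiv_cons x s t : tuple_equiv s t -> tuple_equiv (x :: s) (x :: t).
Proof.
elim=> [?|u v w a b ab ab1 _ IH]; first exact: tuple_equiv_refl.
by rewrite -cat_cons; apply: tuple_equiv_swap.
Qed.

Lemma tuple_equiv_move x u v :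
  {in u, forall y, y != x /\ `|y - x| != 1} -> tuple_equiv (u ++ x :: v) (x :: u ++ v).
Proof.
elim/last_ind: u v => [|u y IH] v h; first exact: tuple_equiv_refl.
have [|yx yx1] := h y; first by rewrite mem_rcons inE eqxx.
rewrite !cat_rcons; apply: tuple_equiv_swap => //; apply: IH => z zu.
by apply: h; rewrite mem_rcons inE zu orbT.
Qed.

Lemma prec_remove x u v y z : y != x -> z != x ->
  prec (u ++ x :: v) y z = prec (u ++ v) y z.
Proof.
move=> yx zx; rewrite /prec !filter_cat /= ![x == _]eq_sym.
by rewrite (negPf yx) (negPf zx).
Qed.

Lemma prec_notin s y z : (y \notin s) || (z \notin s) -> prec s y z = false.
Proof. by rewrite -negb_and; apply: contraNF => /prec_mem. Qed.

(** The first entry [x] of [t] can be moved to the front of [s]: an entry before it in [s] that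
    differed from it by 1 would come after it in [t], against the hypothesis. Removing [x] from both
    keeps the remaining orders. *)
Lemma eq_prec_tuple_equiv s t : uniq s -> perm_eq s t ->
  (forall x y, `|x - y| = 1 -> prec s x y = prec t x y) -> tuple_equiv s t.
Proof.
elim: t s => [|x t IH] s us st pr.
  by rewrite (perm_nilP st); apply: tuple_equiv_refl.
have ut : uniq (x :: t) by rewrite -(perm_uniq st).
have xs : x \in s by rewrite (perm_mem st) mem_head.
case/path.splitPr: xs us st pr => u v us st pr.
have uv : perm_eq (u ++ v) t.
  by rewrite -(perm_cons x) -(permPr st) perm_sym perm_catC /= perm_cons perm_catC.
have xuv : x \notin u ++ v by rewrite (perm_mem uv); case/andP: ut.
apply: (@tuple_equiv_trans _ (x :: u ++ v)).
  apply: tuple_equiv_move => y yu.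
  have yx : y != x by apply: contraNneq xuv => <-; rewrite mem_cat yu.
  split=> //; apply/negP => /eqP yx1; have := pr _ _ yx1.
  have [-> _] := prec_cat_mem us yu (mem_head x v).
  have yt : y \in t by rewrite -(perm_mem uv) mem_cat yu.
  by have [_ /negPf ->] := @prec_cat_mem _ [:: x] t x y ut (mem_head _ _) yt.
apply/tuple_equiv_cons/IH => //; first by rewrite (perm_uniq uv); case/andP: ut.
move=> y z yz; have [ey|yx] := eqVneq y x.
  by rewrite !prec_notin // ey -?(perm_mem uv) xuv.
have [ez|zx] := eqVneq z x.
  by rewrite !prec_notin // ez -?(perm_mem uv) xuv orbT.
by rewrite -(prec_remove _ _ yx zx) pr // (@prec_remove x [::] t).
Qed.

End Equivalence.

Section ColumnStandardForm.
Implicit Types (c : seq (int * int)) (t : seq int) (h : nat).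

Definition csf_shape c :=
  sorted (fun x y : int * int => y.2 < x.2) c /\
  all (fun x : int * int => 0 <= x.1 <= x.2) c.

Definition csf_tuple c := flatten [seq string x.1 x.2 | x <- c].

Lemma string0S h : string 0 h.+1%:Z = rcons (string 0 h%:Z) h.+1%:Z.
Proof.
rewrite (@string_cat _ h%:Z) -?cats1; [|lia|lia].
by have -> : h%:Z + 1 = h.+1%:Z; [lia | rewrite string1].
Qed.

(** Any order pattern [d] is realised by adding [h + 1] to a form of 0:h. If it must precede [h], it
    becomes a new first string; otherwise it extends the first string, which ends at [h]. *)
Lemma csf_exists h (d : nat -> bool) : exists a c,
  [/\ csf_shape ((a, h%:Z) :: c),
      perm_eq (csf_tuple ((a, h%:Z) :: c)) (string 0 h%:Z)
    & forall x, (x < h)%N ->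
        prec (csf_tuple ((a, h%:Z) :: c)) x.+1%:Z x%:Z = d x].
Proof.
elim: h => [|h [a [c [[so al] pe pr]]]]; first by exists 0, [::].
have us : uniq (csf_tuple ((a, h%:Z) :: c)) by rewrite (perm_uniq pe) string_uniq.
have hs : h%:Z \in csf_tuple ((a, h%:Z) :: c) by rewrite (perm_mem pe) mem_string; lia.
have h1s : h.+1%:Z \notin csf_tuple ((a, h%:Z) :: c) by rewrite (perm_mem pe) mem_string; lia.
have /= /andP[ah al'] := al.
case dh : (d h).
  have e : csf_tuple ((h.+1%:Z, h.+1%:Z) :: (a, h%:Z) :: c) =
      h.+1%:Z :: csf_tuple ((a, h%:Z) :: c) by rewrite /csf_tuple /= string1.
  exists h.+1%:Z, ((a, h%:Z) :: c); rewrite e; split.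
  - split; first by move: so => /= ->; rewrite andbT; lia.
    by rewrite /= al' ah; lia.
  - by rewrite string0S perm_sym perm_rcons perm_cons perm_sym.
  move=> x; rewrite ltnS leq_eqVlt => /orP[/eqP ->|xh].
    have u1 : uniq ([:: h.+1%:Z] ++ csf_tuple ((a, h%:Z) :: c)) by rewrite /= h1s.
    by rewrite dh; have [] := prec_cat_mem u1 (mem_head _ _) hs.
  rewrite -(pr _ xh); apply: (@prec_remove h.+1%:Z [::]); lia.
have e : csf_tuple ((a, h.+1%:Z) :: c) = string a h%:Z ++ h.+1%:Z :: csf_tuple c.
  rewrite /csf_tuple /= (@string_cat a h%:Z); [|lia|lia].
  by have -> : h%:Z + 1 = h.+1%:Z; [lia | rewrite string1 -catA].
have pe' : perm_eq (csf_tuple ((a, h.+1%:Z) :: c)) (string 0 h.+1%:Z).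
  by rewrite e perm_catC /= string0S perm_sym perm_rcons perm_cons perm_sym perm_catC.
exists a, c; split=> //.
- split; last by rewrite /= al' andbT; lia.
  by move: so; rewrite /=; case: c {al pe pr us hs h1s al' e pe'} => //= b c /andP[bh ->]; rewrite andbT; lia.
move=> x; rewrite ltnS leq_eqVlt => /orP[/eqP ->|xh].
  rewrite dh e; apply/negbTE.
  have hst : h%:Z \in string a h%:Z by rewrite mem_string; lia.
  have h1c : h.+1%:Z \in h.+1%:Z :: csf_tuple c by rewrite mem_head.
  by have [] := prec_cat_mem _ hst h1c; rewrite // -e (perm_uniq pe') string_uniq.
by rewrite e -(pr _ xh); apply: prec_remove; lia.
Qed.

Lemma csf_tuple_le c x b : path (fun x y : int * int => y.2 < x.2) b c ->
  x \in csf_tuple c -> x <= b.2.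
Proof.
elim: c b => //= y c IH b /andP[yb p]; rewrite mem_cat mem_string => /orP[|/IH h]; first lia.
by have := h _ p; lia.
Qed.

(** Inside a string consecutive integers are in order, while at the lower end [a > 0] of a string
    the integer [a - 1] belongs to a later string. Each string but the last thus accounts for one
    [x] with [x + 1] before it. *)
Lemma size_csf c h : csf_shape c -> perm_eq (csf_tuple c) (string 0 h%:Z) ->
  size c = (bodycnt (fun x => prec (csf_tuple c) x.+1%:Z x%:Z) h).+1.
Proof.
elim: c h => [|[a b] c IH] h.
  by move=> _ /perm_mem /(_ 0); rewrite mem_string in_nil; lia.
move=> [/= so /andP[ab al]] pe.
have us : uniq (csf_tuple ((a, b) :: c)) by rewrite (perm_uniq pe) string_uniq.
have ebh : b = h%:Z.
  have : b \in csf_tuple ((a, b) :: c).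
    by rewrite mem_cat mem_string /=; apply/orP; left; lia.
  rewrite (perm_mem pe) mem_string => bh.
  have : h%:Z \in csf_tuple ((a, b) :: c) by rewrite (perm_mem pe) mem_string; lia.
  rewrite mem_cat mem_string /= => /orP[|/(csf_tuple_le so) /=]; lia.
subst b; set f := fun x => _.
have fst i : a <= i%:Z -> (i < h)%N -> ~~ f i.
  move=> ai ih; have [] := @string_prec a h%:Z i%:Z _ us ai; first lia.
  by rewrite -PoszD addn1.
(* Either the first string is all of 0:h and no other is left, or it starts at the successor of the
   new [a] and the other strings exhaust 0:a. *)
case: a ab us pe so @f fst => // -[|a] ab us pe so f fst.
  have : perm_eq (csf_tuple c) [::].
    by rewrite -(perm_cat2l (string 0 h%:Z)) cats0.
  move/perm_nilP; case: c {IH so pe us} al @f fst => [|[a' b'] c] al f fst e.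
    by rewrite -(@bodycnt_const _ 0 h) ?/bodycnt ?big_ord0 // => i ih; apply: fst; lia.
  have : a' \in csf_tuple ((a', b') :: c).
    by move: al => /= /andP[al _]; rewrite mem_cat mem_string /=; apply/orP; left; lia.
  by rewrite e.
have ea : string 0 h%:Z = string 0 a%:Z ++ string a.+1%:Z h%:Z.
  rewrite (@string_cat 0 a%:Z); [|lia|lia].
  by have -> : a%:Z + 1 = a.+1%:Z by lia.
have pe' : perm_eq (csf_tuple c) (string 0 a%:Z).
  by rewrite -(perm_cat2l (string a.+1%:Z h%:Z)) perm_sym perm_catC perm_sym -ea.
have -> := IH a (conj (path_sorted so) al) pe'.
have ah : (a < h)%N by move: ab => /=; lia.
rewrite -(@bodycnt_const f a.+1 h) // => [|i ih]; last by apply: fst; lia.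
have fa : f a.
  have h1 : a.+1%:Z \in string a.+1%:Z h%:Z by rewrite mem_string; move: ab => /=; lia.
  have h2 : a%:Z \in csf_tuple c by rewrite (perm_mem pe') mem_string; lia.
  by have [] := @prec_cat_mem _ _ (csf_tuple c) _ _ us h1 h2.
rewrite bodycntS fa addn1; congr _.+2; apply: eq_bigr => i _.
by rewrite /f [csf_tuple (_ :: _)]/(_ ++ csf_tuple c) prec_catr ?mem_string /= //; have := ltn_ord i; lia.
Qed.

(** [csf_exists], applied to the order pattern of [t], shows that [xget] returns a genuine column
    standard form. [size_csf] counts its strings through the order of consecutive integers, which
    equivalence preserves. *)
Lemma nheads_perm t h : perm_eq t (string 0 h%:Z) ->
  nheads t = (bodycnt (fun x => prec t x.+1%:Z x%:Z) h).+1.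
Proof.
move=> pe; have ut : uniq t by rewrite (perm_uniq pe) string_uniq.
have [a [c [[so al] pc pr]]] := csf_exists h (fun x => prec t x.+1%:Z x%:Z).
set c0 := (a, h%:Z) :: c in so al pc pr.
have uc : uniq (csf_tuple c0) by rewrite (perm_uniq pc) string_uniq.
have ex : is_csf t c0.
  split=> //; apply: eq_prec_tuple_equiv => //; first by rewrite (permPl pe) perm_sym.
  have pS i : prec t i.+1%:Z i%:Z = prec (csf_tuple c0) i.+1%:Z i%:Z.
    have [ih|hi] := ltnP i h; first by rewrite pr.
    by rewrite !prec_notin // (perm_mem pe, perm_mem pc) mem_string; lia.
  have pS' i : prec t i%:Z i.+1%:Z = prec (csf_tuple c0) i%:Z i.+1%:Z.
    have [ih|hi] := ltnP i h; last first.
      by rewrite !prec_notin // !(perm_mem pe, perm_mem pc) !mem_string; lia.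
    rewrite !(@prec_asym _ _ i%:Z) ?pS //; rewrite ?(perm_mem pe) ?(perm_mem pc) ?mem_string; lia.
  have ct : csf_tuple c0 =i t by move=> z; rewrite (perm_mem pc) (perm_mem pe).
  move=> x y xy.
  have [xt|xt] := boolP (x \in t); last first.
    by rewrite !prec_notin // ?ct xt.
  have [yt|yt] := boolP (y \in t); last first.
    by rewrite !prec_notin // ?ct yt orbT.
  move: xt yt; rewrite !(perm_mem pe) !mem_string.
  case: x xy => // x xy; case: y xy => // y xy _ _.
  have [->|->] : x = y.+1 \/ y = x.+1 by lia.
    exact: pS.
  exact: pS'.
have [so1 al1 eq1] : is_csf t (csf t) by apply: classical_sets.xgetPex; exists c0.
rewrite /nheads size_map (@size_csf _ h) //.
  by congr _.+1; apply: eq_bigr => i _; rewrite (tuple_equiv_prec _ eq1) //; lia.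
by rewrite -(permPl (tuple_equiv_perm eq1)).
Qed.

End ColumnStandardForm.

(** * From index tuples of integers to tuples of natural numbers *)

Lemma Posz_inj : injective Posz. Proof. by move=> i j []. Qed.

Lemma SIP_colbody (t : seq nat) x : uniq t ->
  SIP (map Posz t ++ [:: x%:Z]) <-> ~~ colbody t x.
Proof.
move=> ut; rewrite SIP_rcons ?map_inj_uniq //; try exact: Posz_inj.
rewrite (mem_map Posz_inj) -PoszD addn1 (prec_map _ _ _ Posz_inj) negb_and negbK -implybE.
by split=> /implyP.
Qed.

Lemma SIP_colbody_rev (t : seq nat) x : uniq t ->
  SIP (x%:Z :: map Posz t) <-> ~~ colbody (rev t) x.
Proof.
move=> ut; rewrite SIP_cons ?map_inj_uniq //; try exact: Posz_inj.
rewrite (mem_map Posz_inj) -PoszD addn1 (prec_map _ _ _ Posz_inj) colbody_rev negb_and negbK -implybE.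
by split=> /implyP.
Qed.

Lemma fiedler_prodQ (F : fieldType) n k (P : 'M[{poly F}]_n) (Q : seq nat) :
  {in Q, forall i, i < k}%N ->
  fiedler_prod k P (map Posz Q) = prodQ k (fun s => coefmx s P) Q.
Proof.
move=> kQ; rewrite /fiedler_prod big_map; apply: eq_big_seq => i /kQ ik.
exact: elem_mx_pos.
Qed.

Lemma fiedler_prodZ (F : fieldType) n k (P : 'M[{poly F}]_n) (Z : seq nat) :
  {in Z, forall e, e < k}%N ->
  fiedler_prod k P [seq - (k - e)%N%:Z | e <- Z] = prodZ k (fun s => coefmx s P) Z.
Proof.
move=> kZ; rewrite /fiedler_prod big_map; apply: eq_big_seq => e /kZ lt_ek.
have ed : (k - e = (k - e.+1).+1)%N by lia.
rewrite ed -NegzE /fiedler_mx elem_mx_neg; last lia.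
by have -> : (k - (k - e.+1).+1 = e)%N by lia.
Qed.

Section IndexTuples.
Variables (k : nat) (C0 C1 : {set 'I_k.+1}) (tq tz : seq int).
Hypothesis wf0 : proper_GFP_tuples C0 C1 tq tz.

Definition natQ : seq nat := map absz tq.
Definition natZ : seq nat := [seq absz (k%:Z + i)%R | i <- tz].

Lemma mem_tq i : (i <= k)%N -> (i%:Z \in tq) = (inord i \in C0).
Proof.
case: wf0 => _ /perm_mem e _ _ _ ik; rewrite e; apply/mapP/idP => [[c]|iC].
  by rewrite mem_enum => cC [->]; rewrite inord_val.
by exists (inord i); rewrite ?mem_enum // inordK.
Qed.

Lemma mem_tz i : (i <= k)%N -> (- i%:Z \in tz) = (inord i \in C1).
Proof.
case: wf0 => _ _ /perm_mem e _ _ ik; rewrite e; apply/mapP/idP => [[c]|iC].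
  by rewrite mem_enum => cC /oppr_inj [->]; rewrite inord_val.
by exists (inord i); rewrite ?mem_enum // inordK.
Qed.

Lemma C1E c : (c \in C1) = (c \notin C0).
Proof.
case: wf0 => -[/setP e /pred0P d] _ _ _ _; move: (e c) (d c); rewrite /= !inE.
by case: (c \in C0); case: (c \in C1).
Qed.

Lemma tq_uniq : uniq tq.
Proof.
case: wf0 => _ e _ _ _; rewrite (perm_uniq e) map_inj_uniq ?enum_uniq //.
by move=> i j [] /val_inj.
Qed.

Lemma tz_uniq : uniq tz.
Proof.
case: wf0 => _ _ e _ _; rewrite (perm_uniq e) map_inj_uniq ?enum_uniq //.
by move=> i j /oppr_inj [] /val_inj.
Qed.

Lemma tq_bound x : x \in tq -> 0 <= x < k%:Z.
Proof.
case: wf0 => -[_ /pred0P d] /perm_mem e _ _ m; rewrite e => /mapP[c].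
rewrite mem_enum => cC ->; have := ltn_ord c; rewrite ltnS leq_eqVlt => /orP[/eqP ck|]; last lia.
by have := d ord_max; rewrite /= m; have <- : c = ord_max by [apply: val_inj]; rewrite cC.
Qed.

Lemma tz_bound x : x \in tz -> - k%:Z <= x < 0.
Proof.
case: wf0 => -[_ /pred0P d] _ /perm_mem e m _; rewrite e => /mapP[c].
rewrite mem_enum => cC ->; have := ltn_ord c => ck; case: (posnP c) => [c0|]; last lia.
by have := d ord0; rewrite /= m; have <- : c = ord0 by [apply: val_inj]; rewrite cC.
Qed.

Lemma natQE : map Posz natQ = tq.
Proof.
rewrite /natQ -map_comp; apply: map_id_in => x /tq_bound /=; lia.
Qed.

Lemma natZE : map Posz natZ = shift_tuple k tz.
Proof.
rewrite /natZ -map_comp; apply/eq_in_map => x /tz_bound /=; lia.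
Qed.

Lemma natZ_opp : [seq - (k - e)%N%:Z | e <- natZ] = tz.
Proof.
rewrite /natZ -map_comp; apply: map_id_in => x /tz_bound /=; lia.
Qed.

Lemma mem_natQ i : (i \in natQ) = (i%:Z \in tq).
Proof. by rewrite -natQE (mem_map Posz_inj). Qed.

Lemma mem_natZ e : (e \in natZ) = (e%:Z - k%:Z \in tz).
Proof.
rewrite -(mem_map Posz_inj) natZE; have -> : e%:Z = k%:Z + (e%:Z - k%:Z) by lia.
by rewrite (mem_map (addrI _)) addrAC subrr add0r.
Qed.

Lemma natQZ_wf : pair_wf k natQ natZ.
Proof.
split.
- by have := tq_uniq; rewrite -natQE => /map_uniq.
- by have := tz_uniq; rewrite -(map_inj_uniq (addrI k%:Z)) -[map _ tz]natZE => /map_uniq.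
- by move=> i; rewrite mem_natQ => /tq_bound; lia.
- by move=> e; rewrite mem_natZ => /tz_bound; lia.
move=> i ik; rewrite mem_natQ mem_natZ mem_tq //.
have -> : (k - i)%N%:Z - k%:Z = - i%:Z by lia.
by rewrite mem_tz // C1E negbK.
Qed.

Lemma prec_natQ x y : prec natQ x y = prec tq x%:Z y%:Z.
Proof. by rewrite -natQE (prec_map _ _ _ Posz_inj). Qed.

Lemma prec_natZ x y : prec natZ x y = prec tz (x%:Z - k%:Z) (y%:Z - k%:Z).
Proof.
rewrite -(prec_map _ _ _ Posz_inj) natZE -(prec_map tz _ _ (addrI k%:Z)).
by rewrite !(addrC k%:Z) !subrK.
Qed.

Variables (hq : seq int) (h : nat).
Hypothesis sp : simple_pair k tq tz hq h.

(* At the position h itself the block-column is always in the body, and the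
   positions above h come from the consecutive string -k:-h-1. *)
Lemma bodyb_simple_pair x : (x < k)%N ->
  bodyb k natQ natZ (k - x.+1) =
  if (x < h)%N then prec hq x.+1%:Z x%:Z else x == h.
Proof.
move=> xk; case: sp => hk [m [ze hqe pe]].
have uh : uniq hq by rewrite (perm_uniq pe) string_uniq.
set str := string (- k%:Z) (- h%:Z - 1) in ze.
have pz := tuple_equiv_perm ze.
have um : uniq (m ++ str) by rewrite -(perm_uniq pz) tz_uniq.
have negK : involutive (fun i : int => - i) := @opprK _.
have mem_neg y : (y \in neg_tuple (rev m)) = (- y \in m).
  by rewrite -{1}[y]opprK (mem_map (inv_inj negK)) mem_rev.
have hqm y : y \in hq = (- y \in m) || (y \in tq) by rewrite hqe mem_cat mem_neg.
have hqb y : y \in hq = (0 <= y <= h%:Z) by rewrite (perm_mem pe) mem_string.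
have tzm y : y \in tz = (y \in m) || (y \in str) by rewrite (perm_mem pz) mem_cat.
have strb y : y \in str = (- k%:Z <= y <= - h%:Z - 1) by rewrite mem_string.
have mq y : - y \in m -> y \in tq = false.
  move=> ym; apply/negP => yq; move: uh; rewrite hqe cat_uniq => /and3P[_ /hasPn/(_ _ yq)].
  by rewrite /= mem_neg ym.
have tzP a b : `|a - b| = 1 -> prec tz a b = prec (m ++ str) a b.
  by move=> ab; apply: tuple_equiv_prec.
rewrite /bodyb /colbody subnSK // !subKn ?leq_subr //; last exact: ltnW.
rewrite mem_natQ prec_natQ mem_natZ prec_natZ.
have -> : (k - x.+1)%N%:Z - k%:Z = - x.+1%:Z by lia.
have -> : (k - x)%N%:Z - k%:Z = - x%:Z by lia.
have [xh|hx] := ltnP x h.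
  have x0 : x%:Z \in hq by rewrite hqb; lia.
  have x1 : x.+1%:Z \in hq by rewrite hqb; lia.
  have nx0 : - x%:Z \notin str by rewrite strb; lia.
  have nx1 : - x.+1%:Z \notin str by rewrite strb; lia.
  rewrite tzm (negPf nx1) orbF tzP; last lia.
  rewrite (prec_catl _ nx1 nx0).
  move: x0 x1; rewrite !hqm.
  (* Each of [x] and [x + 1] comes from [m] or from [tq]. Two indices from [m] appear in [hq] in
     reversed order; in the mixed cases the one from [m] comes first in [hq]. *)
  have [xm _|xm /= xq] := boolP (- x%:Z \in m); have [x1m _|x1m /= x1q] := boolP (- x.+1%:Z \in m).
  - rewrite mq // hqe prec_catl ?mq //.
    have -> : prec (neg_tuple (rev m)) x.+1%:Z x%:Z = prec (rev m) (- x.+1%:Z) (- x%:Z).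
      by rewrite -(prec_map (rev m) _ _ (@oppr_inj int)) !opprK.
    rewrite prec_rev [in RHS]prec_asym //; last lia.
    by move: um; rewrite cat_uniq => /and3P[].
  - rewrite mq //= prec_asym //; [|lia|by rewrite hqm x1q orbT|by rewrite hqm xm].
    have xh' : x%:Z \in neg_tuple (rev m) by rewrite mem_neg.
    by move: uh; rewrite hqe => uh; have [-> _] := prec_cat_mem uh xh' x1q.
  - rewrite xq prec_notin ?(mq x.+1%:Z) ?orbT //=.
    have xh' : x.+1%:Z \in neg_tuple (rev m) by rewrite mem_neg.
    by move: uh; rewrite hqe => uh; have [-> _] := prec_cat_mem uh xh' xq.
  - rewrite xq /= orbF hqe prec_catr ?mem_neg //.
    by rewrite [in RHS]prec_asym ?tq_uniq //; lia.
have x1s : - x.+1%:Z \in str by rewrite strb; lia.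
have x1q : x.+1%:Z \in tq = false by apply/negP => h'; have := hqm x.+1%:Z; rewrite h' orbT hqb; lia.
rewrite prec_notin ?x1q ?orbT //= andbT tzm x1s orbT /= tzP; last lia.
have [exh|xh] := eqVneq x h.
  have : x%:Z \in hq by rewrite hqb; lia.
  rewrite hqm => /orP[hm|-> //].
  rewrite mq //=.
  by have [_] := prec_cat_mem um hm x1s.
have -> : x%:Z \in tq = false.
  by apply/negP => h'; have := hqm x%:Z; rewrite h' orbT hqb; lia.
rewrite /=; apply/negbTE; rewrite negbK.
have es : str = string (- k%:Z) (- x.+1%:Z) ++ string (- x%:Z) (- h%:Z - 1).
  rewrite /str (@string_cat _ (- x.+1%:Z)); [|lia|lia].
  by have -> : - x.+1%:Z + 1 = - x%:Z by lia.
have x1s' : - x.+1%:Z \in m ++ string (- k%:Z) (- x.+1%:Z).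
  by rewrite mem_cat mem_string; apply/orP; right; lia.
have xs' : - x%:Z \in string (- x%:Z) (- h%:Z - 1) by rewrite mem_string; lia.
rewrite es catA in um *; by have [] := prec_cat_mem um x1s' xs'.
Qed.

(** Numbered from the last position, the body block-columns are [h] and the [x < h] with [x + 1]
    before [x] in [hq], as many as there are heads. *)
Lemma bodycnt_nheads : bodycnt (bodyb k natQ natZ) k = nheads hq.
Proof.
have [hk [m [_ _ pe]]] := sp; rewrite (nheads_perm pe).
rewrite /bodycnt (reindex_inj rev_ord_inj) /=.
under eq_bigr do rewrite bodyb_simple_pair //.
pose f x := if (x < h)%N then prec hq x.+1%:Z x%:Z else x == h.
rewrite -/(bodycnt f k) -(@bodycnt_const f h.+1 k) //; last first.
  by move=> i ih; rewrite /f; case: ltnP; lia.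
rewrite bodycntS {2}/f ltnn eqxx addn1; congr _.+1; apply: eq_bigr => i _.
by rewrite /f ltn_ord.
Qed.

(** Each [x < h] is a head for exactly one of [hq] and its reversal, and [h] is a head for both. *)
Lemma nheads_rev : (nheads hq + nheads (rev hq) = h + 2)%N.
Proof.
have [hk [m [_ _ pe]]] := sp.
have per : perm_eq (rev hq) (string 0 h%:Z) by rewrite perm_rev.
have uh : uniq hq by rewrite (perm_uniq pe) string_uniq.
rewrite (nheads_perm pe) (nheads_perm per).
rewrite (_ : bodycnt (fun x => prec (rev hq) _ _) h =
  bodycnt (fun x => ~~ prec hq x.+1%:Z x%:Z) h).
  by have := bodycntC (fun x => prec hq x.+1%:Z x%:Z) h; lia.
apply: eq_bigr => i _; have ih := ltn_ord i.
by rewrite prec_rev prec_asym // ?(perm_mem pe) ?mem_string; lia.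
Qed.

End IndexTuples.

Theorem theorem7p1 (F : fieldType) (n k : nat) (P : 'M[{poly F}]_n)
    (C0 C1 : {set 'I_k.+1}) (tq tz hq : seq int) (h : nat) :
  (2 <= k)%N ->
  has_grade k P ->
  proper_GFP_tuples C0 C1 tq tz ->
  simple_pair k tq tz hq h ->
  let p := (nheads hq - 1)%N in
  let q := (nheads (rev hq) + k - h - 2)%N in
  let K := GFP k P tq tz in
  exists (l r : 'S_k) (M : 'M[{poly F}]_(q.+1 * n, p.+1 * n)),
    let Pil := block_trmx (block_perm_mx {poly F} n l) in
    let Pir := block_perm_mx {poly F} n r in
    [/\ is_block_kronecker (Pil *m K *m Pir) M,
        AS_condition M P,
        (forall j : 'I_k, j \in wing_cols r p ->
           exists2 i : nat, (1 <= i <= q)%N &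
             block_col (Pil *m K) j
             = - (ecol {poly F} k i *t (1%:M : 'M_n))
               + 'X *: (ecol {poly F} k i.+1 *t (1%:M : 'M_n)))
        /\
        (forall j : 'I_k, j \in wing_cols r p <->
           SIP (tq ++ [:: k%:Z - j.+1%:Z]) /\
           SIP (shift_tuple k%:Z tz ++ [:: j.+1%:Z - 1]))
      & (forall j : 'I_k, j \in wing_rows l q ->
           exists2 i : nat, (1 <= i <= p)%N &
             block_row (K *m Pir) j
             = - ((ecol {poly F} k i)^T *t (1%:M : 'M_n))
               + 'X *: ((ecol {poly F} k i.+1)^T *t (1%:M : 'M_n)))
        /\
        (forall j : 'I_k, j \in wing_rows l q <->
           SIP ((k%:Z - j.+1%:Z) :: tq) /\
           SIP ((j.+1%:Z - 1) :: shift_tuple k%:Z tz))].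
Proof.
move=> _ _ wf0 sp p q K.
have wf := natQZ_wf wf0; set Q := natQ tq in wf; set Z := natZ k tz in wf.
have [uQ uZ kQ kZ QZ] := wf.
have hk : (h < k)%N by case: sp.
have cb := bodycnt_nheads wf0 sp; have hh := nheads_rev sp.
(* Taken at [e = k], which is not in [Z], the count gives [k + 1] body rows and columns together. *)
have := bodycnt_sum wf (leqnn k); have -> : k \notin Z by apply/negP => /kZ; rewrite ltnn.
(* With both numbers of heads positive and [h < k], the truncated subtractions in [p] and [q] are
   exact. *)
rewrite cb => rb; have [h1 h2] : (0 < nheads hq)%N /\ (0 < nheads (rev hq))%N.
  case: sp => _ [m [_ _ pe]]; split; first by rewrite (nheads_perm pe).
  by rewrite (@nheads_perm _ h) // perm_rev.
have ep : p.+1 = bodycnt (bodyb k Q Z) k by rewrite cb /p; lia.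
have eqr : q.+1 = bodycnt (bodyb k (rev Q) (rev Z)) k by rewrite /q; lia.
have ek : k = (p + q + 1)%N by rewrite /p /q; lia.
have [l hl] := bodypos_perm (bodyb k (rev Q) (rev Z)) k.
have [r hr] := bodypos_perm (bodyb k Q Z) k.
have eK : K = pencil (prodZ k (fun s => coefmx s P) Z) (- prodQ k (fun s => coefmx s P) Q).
  rewrite /K /GFP -{1}(natZ_opp wf0) -{1}(natQE wf0).
  by rewrite fiedler_prodQ ?fiedler_prodZ.
clearbody p q; exists l, r, (body (fun s => coefmx s P) ek ep eqr l r).
have jS (j : 'I_k) : k%:Z - j.+1%:Z = (k - j.+1)%N%:Z by have := ltn_ord j; lia.
have jP (j : 'I_k) : j.+1%:Z - 1 = j%:Z by lia.
rewrite eK -(natQE wf0) -(natZE wf0) -/Q -/Z; split.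
- exact: body_is_block_kronecker.
- by move=> s; rewrite -ek; apply: AS_body.
- split=> j; first exact: wing_col_form.
  rewrite jS jP !SIP_colbody // (mem_wing_cols ep hr) negb_or.
  by split=> /andP.
- split=> j; first exact: wing_row_form.
  rewrite jS jP !SIP_colbody_rev // (mem_wing_rows eqr hl) negb_or.
  by split=> /andP.
Qed.
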